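(* Let $J=[0,T]$ with $T>0$, let $0<\alpha<1$, let $\omega_0\in\mathbb{R}$, let $f\in C(J\times\mathbb{R},\mathbb{R}\setminus\{0\})$ be such that $\tau\mapsto u/f(\tau,u)$ is absolutely continuous on $J$ for each $u\in\mathbb{R}$, and let $g\in C(J\times\mathbb{R},\mathbb{R})$ satisfy $g(0,\omega_0)=0$. Suppose that: (1) there is $L>0$ with $|f(\tau,x)-f(\tau,y)|\le L|x-y|$ for all $\tau\in J$ and $x,y\in\mathbb{R}$; (2) for each $\tau\in J$ the map $x\mapsto \dfrac{x}{f(\tau,x)}$ is strictly increasing on $\mathbb{R}$; (3) there is $h\in C(J,\mathbb{R}^+)$ with $|g(\tau,x)|\le h(\tau)$ for a.e. $\tau\in J$ and all $x\in\mathbb{R}$; (4) with $\|h\|=\sup_{\tau\in J}|h(\tau)|$, $$ L\left(\left|\frac{\omega_0}{f(0,\omega_0)}\right|+\left[1-\alpha+\frac{T^\alpha}{1-\alpha}\right]\frac{\|h\|}{B(\alpha)}\right)<1; $$ (5) there is a constant $K$ with $0<K<\dfrac{B(\alpha)}{1-\alpha}$ such that $g(\tau,x)-g(\tau,y)\le K\left(\dfrac{x}{f(\tau,x)}-\dfrac{y}{f(\tau,y)}\right)$ for all $\tau\in J$ and all $x,y\in\mathbb{R}$ with $x\ge y$. If $u\in AC(J,\mathbb{R})$ is a function such that $\tau\mapsto u(\tau)/f(\tau,u(\tau))$ has an ABC-derivative and $$ {}^{ABC}{}_0\mathcal{D}^\alpha_\tau\left[\frac{u(\tau)}{f(\tau,u(\tau))}\right]\le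 g(\tau,u(\tau))\ \text{ for a.e. }\tau\in J,\qquad u(0)\le\omega_0, $$ then $u(\tau)\le r(\tau)$ for all $\tau\in J$, where $r$ is the maximal solution of the ABC-hybrid problem $$ {}^{ABC}{}_0\mathcal{D}^\alpha_\tau\left(\frac{\omega(\tau)}{f(\tau,\omega(\tau))}\right)=g(\tau,\omega(\tau))\ \text{ for a.e. }\tau\in J,\qquad \omega(0)=\omega_0. $$
   Context: $AC(J,\mathbb{R})$ is the set of absolutely continuous functions $J\to\mathbb{R}$. $B$ is a fixed normalization function on $[0,1]$ with $B(\alpha)>0$ and $B(0)=B(1)=1$. $\mathbb{E}_\alpha(z)=\sum_{n=0}^\infty \frac{z^n}{\Gamma(n\alpha+1)}$ is the one-parameter Mittag-Leffler function. For $x\in H^1(0,T)$ the left Atangana--Baleanu--Caputo (ABC) fractional derivative of order $\alpha$ is $$ {}^{ABC}{}_0\mathcal{D}^\alpha_\tau x(\tau)=\frac{B(\alpha)}{1-\alpha}\int_0^\tau \mathbb{E}_\alpha\left[-\frac{\alpha}{1-\alpha}(\tau-\sigma)^\alpha\right]x'(\sigma)\,d\sigma ; $$ saying that $x$ has an ABC-derivative means $x\in H^1(0,T)$. A solution of the ABC-hybrid problem is a function $\omega\in AC(J,\mathbb{R})$ such that $F_\omega(\tau)=\omega(\tau)/f(\tau,\omega(\tau))$ has an ABC-derivative in $C(J)$, the differential equation holds for a.e. $\tau\in J$, and $\omega(0)=\omega_0$. A solution $r$ is maximal if every solution $\omega$ of the same problem satisfies $\omega(\tau)\le r(\tau)$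 for all $\tau\in J$. *)

(* Defs.v *)
From HB Require Import structures.
From mathcomp Require Export all_boot all_order all_algebra.
From mathcomp Require Export all_classical all_reals all_analysis.

Set Implicit Arguments.
Unset Strict Implicit.
Unset Printing Implicit Defensive.

Export Order.TTheory GRing.Theory Num.Theory.
Export numFieldNormedType.Exports.

Local Open Scope classical_set_scope.
Local Open Scope ring_scope.

(* Functions on J = [0, T] are total functions on R of which only the values
   on J matter. *)

Definition Gamma {R : realType} (x : R) : R :=
  \int[lebesgue_measure]_(t in `]0%R, +oo[) (t `^ (x - 1) * expR (- t)).

Definition mittag_leffler {R : realType} (a z : R) : R :=
  limn (series (fun n : nat => z ^+ n / Gamma (n%:R * a + 1))).

Definition abs_continuous {R : realType} (T : R) (x : R -> R) : Prop :=
  forall e : R, 0 < e -> exists2 d : R, 0 < d &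
    forall (n : nat) (a b : 'I_n -> R),
      (forall i, [/\ 0 <= a i, a i <= b i & b i <= T]) ->
      trivIset setT (fun i => `]a i, b i[%classic) ->
      \sum_(i < n) (b i - a i) < d ->
      \sum_(i < n) `|x (b i) - x (a i)| < e.

Definition square_integrable {R : realType} (T : R) (x : R -> R) : Prop :=
  x \_ `]0, T[ \in Lfun (@lebesgue_measure R) 2%:E.

(* Test functions are C^1 with compact support in (0, T), as is usual for
   Sobolev spaces in dimension one; for square integrable functions this gives
   the same weak derivatives as smooth test functions. *)
Definition test_function {R : realType} (T : R) (phi : R -> R) : Prop :=
  [/\ forall t, derivable phi t 1,
      continuous phi^`()%classic &
      exists a b : R, [/\ 0 < a, b < T &
        forall t, ~ (a <= t <= b) -> phi t = 0]].

Definition is_weak_derivative {R : realType} (T : R) (x v : R -> R) : Prop :=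
  forall phi : R -> R, test_function T phi ->
    \int[lebesgue_measure]_(t in `]0, T[) (x t * phi^`()%classic t) =
    - \int[lebesgue_measure]_(t in `]0, T[) (v t * phi t).

Definition H1_derivatives {R : realType} (T : R) (x : R -> R) : set (R -> R) :=
  [set v | square_integrable T v /\ is_weak_derivative T x v].

Definition in_H1 {R : realType} (T : R) (x : R -> R) : Prop :=
  square_integrable T x /\ exists v, H1_derivatives T x v.

(* Any two elements of H1_derivatives T x agree a.e. on (0, T), so the choice
   made here does not affect integrals over subintervals of J. *)
Definition weak_derive {R : realType} (T : R) (x : R -> R) : R -> R :=
  xget (fun _ => 0) (H1_derivatives T x).

Definition ABC_derive {R : realType} (B : R -> R) (alpha T : R) (x : R -> R)
    (tau : R) : R :=
  B alpha / (1 - alpha) *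
  \int[lebesgue_measure]_(s in `[0, tau])
    (mittag_leffler alpha (- (alpha / (1 - alpha)) * (tau - s) `^ alpha) *
     weak_derive T x s).

Definition hybrid_quotient {R : realType} (f : R -> R -> R) (w : R -> R) :
    R -> R :=
  fun tau => w tau / f tau (w tau).

Definition is_solution {R : realType} (B : R -> R) (alpha T w0 : R)
    (f g : R -> R -> R) (w : R -> R) : Prop :=
  [/\ abs_continuous T w,
      in_H1 T (hybrid_quotient f w),
      {within `[0, T], continuous (ABC_derive B alpha T (hybrid_quotient f w))},
      {ae lebesgue_measure, forall tau : R, 0 <= tau <= T ->
        ABC_derive B alpha T (hybrid_quotient f w) tau = g tau (w tau)} &
      w 0 = w0].

Definition is_maximal_solution {R : realType} (B : R -> R) (alpha T w0 : R)
    (f g : R -> R -> R) (r : R -> R) : Prop :=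
  is_solution B alpha T w0 f g r /\
  forall w, is_solution B alpha T w0 f g w ->
    forall tau, 0 <= tau <= T -> w tau <= r tau.

(* Main.v *)
Require Import Defs.
From mathcomp Require Import measurable_realfun ring lra.

Set Implicit Arguments.
Unset Strict Implicit.
Unset Printing Implicit Defensive.

Local Open Scope classical_set_scope.
Local Open Scope ring_scope.

(** Write U = u / f(., u), V = r / f(., r) and m = U - V.  Since x / f(t, x) is
    strictly increasing in x, the claim u <= r says that m <= 0 on J, and the
    one-sided bound on g says that m is a subsolution of a linear problem: for
    almost every t with m t > 0,
      c * int_0^t k(t - s) m'(s) ds <= K * m t,   c = B(alpha) / (1 - alpha),
    where k(t) = E_alpha(- alpha / (1 - alpha) * t^alpha) and K < c.

    Everything rests on the shape of the kernel: k(0) = 1 and k is nonnegative,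
    nonincreasing and continuous at 0.  Suppose that m <= 0 on [0, a], and that
    on [a, a + d] the maximum of m is M > 0.  As s |-> k(t - s) is nondecreasing,
    the second mean value argument of [monotone_weight_le] gives, at points t
    near a maximum point,
      int_0^t k(t - s) m'(s) ds >= k(t - a) m t - e >= k(d) m t - e
    with e as small as desired ([convolution_lower_bound]).  When d is so small
    that c * k(d) > K this contradicts the inequality above.  Hence m <= 0
    propagates from [0, a] to [0, a + d], where d does not depend on a, and
    finitely many steps cover J ([volterra_comparison]).

    The shape of k is the classical fact that x |-> E_alpha(- x) is nonnegative
    and nonincreasing for 0 < alpha <= 1.  It is obtained from the discrete
    approximations
      F_n(x) = sum_j (- x)^j prod_(i = 1..n) (1 + j alpha / i),   0 <= x < 1.
    The product, as a function of j, is a combination with nonnegative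
    coefficients of the binomials C(j + k, k) for k = 0, ..., n
    ([binom_prod_newton]), and sum_j C(j + k, k) (- x)^j = (1 + x)^-(k + 1);
    so F_n is a combination with nonnegative coefficients of powers of
    1 / (1 + x), hence nonnegative and nonincreasing.  By the product formula of
    Gauss, n^(- j alpha) prod_i (1 + j alpha / i) decreases to
    1 / Gamma(j alpha + 1), and dominated convergence of series gives
    F_n(y / n^alpha) --> E_alpha(- y).

    The quotients U and V are continuous, and they are recovered from their weak
    derivatives by integration, which follows by testing against smoothed
    indicators of intervals ([weak_derivative_primitive]). *)

(** * The Gamma function and its product formula *)

Section gamma.
Context {R : realType}.
Implicit Types (x t b : R).
Local Notation mu := (@lebesgue_measure R).

Definition gamma_density x t := t `^ (x - 1) * expR (- t).

Lemma powR_le_expR x t : 0 < x -> 0 <= t ->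
  t `^ x <= (2 * x) `^ x * expR (t / 2).
Proof.
move=> x0 t0; have x20 : 0 < 2 * x by rewrite mulr_gt0.
have e1 : t / (2 * x) <= expR (t / (2 * x)).
  by apply: le_trans (expR_ge1Dx _); rewrite lerDr.
have tx0 : 0 <= t / (2 * x) by rewrite divr_ge0 // ltW.
rewrite -[in leLHS](@divfK _ (2 * x) _ t) ?gt_eqF// [in leLHS]mulrC.
rewrite (powRM _ (ltW x20) tx0) ler_wpM2l ?powR_ge0//.
have -> : t / 2 = t / (2 * x) * x by field; rewrite gt_eqF.
by rewrite expRM ge0_ler_powR ?nnegrE ?expR_ge0 // ltW.
Qed.

Lemma gamma_density_ge0 x t : 0 <= gamma_density x t.
Proof. by rewrite mulr_ge0 ?powR_ge0 ?expR_ge0. Qed.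

Lemma measurable_gamma_density x (A : set R) : measurable_fun A (gamma_density x).
Proof.
apply: (@measurable_funTS) => //; apply: measurable_funM => //.
by apply: measurableT_comp => //.
Qed.

Lemma exp_half_cvg (c : R) : c * expR (- (2^-1 * t)) @[t --> +oo] --> 0.
Proof.
rewrite -(mulr0 c); apply: cvgMr.
apply: (@cvg_comp _ _ _ (fun t => 2^-1 * t) (fun x => expR (- x)) _ (pinfty_nbhs R)).
  exact: gt0_cvgMry.
exact: cvgr_expR.
Qed.

(** The explicit integral that serves both as a majorant of the densities of
    Gamma and as the positive correction in [Gamma_succ]. *)
Lemma exp_half_FTC (c : R) : 0 <= c ->
  (\int[mu]_(t in `[0%R, +oo[) (c * expR (- (2^-1 * t)))%:E = (2 * c)%:E)%E.
Proof.
move=> c0.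
have dF t : is_derive t 1 (fun t : R => - (2 * c) * expR (- (2^-1 * t))) (c * expR (- (2^-1 * t))).
  apply: is_derive_eq.
  by rewrite /GRing.scale/= mulr1; field.
have cF : continuous (fun t : R => - (2 * c) * expR (- (2^-1 * t))).
  by move=> t; apply: differentiable_continuous; exact/derivable1_diffP.
rewrite (@ge0_continuous_FTC2y _ _ (fun t => - (2 * c) * expR (- (2^-1 * t))) _ 0)//.
- by rewrite mulr0 oppr0 expR0 mulr1 -EFinB sub0r opprK.
- by move=> t _; rewrite mulr_ge0 ?expR_ge0.
- apply: continuous_subspaceT => t; apply: cvgMr; apply: continuous_comp; last exact: continuous_expR.
  by apply: cvgN; apply: cvgMr.
- exact: exp_half_cvg.
- exact/cvg_at_right_filter/cF.
- by move=> t _; rewrite derive1E; exact: derive_val.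
Qed.

Lemma integrable_exp_half (c : R) : 0 <= c ->
  mu.-integrable `[0%R, +oo[ (fun t => (c * expR (- (2^-1 * t)))%:E).
Proof.
move=> c0; apply/integrableP; split.
  apply/measurable_EFinP; apply: measurable_funM => //.
  by apply: measurableT_comp => //; apply: measurableT_comp => //.
under eq_integral => t _ do rewrite gee0_abs ?lee_fin ?mulr_ge0 ?expR_ge0//.
by rewrite exp_half_FTC// ltry.
Qed.

Lemma powR_dominated x : 0 <= x ->
  exists2 c : R, 0 <= c & forall t, 0 <= t -> t `^ x <= c * expR (t / 2).
Proof.
rewrite le_eqVlt => /predU1P[<-|x0].
  exists 1 => // t t0; rewrite powRr0 mul1r -expR0 ler_expR.
  by rewrite divr_ge0.
by exists ((2 * x) `^ x) => [|t]; [exact: powR_ge0|exact: powR_le_expR].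
Qed.

Lemma gamma_density_dominated x : 1 <= x ->
  exists2 c : R, 0 <= c &
    forall t, 0 <= t -> gamma_density x t <= c * expR (- (2^-1 * t)).
Proof.
rewrite -subr_ge0 => /powR_dominated[c c0 cP]; exists c => // t /cP ct.
rewrite /gamma_density (_ : - (2^-1 * t) = t / 2 - t); last by field.
by rewrite expRD mulrA ler_wpM2r ?expR_ge0.
Qed.

Lemma integrable_gamma_density x : 1 <= x ->
  mu.-integrable `[0%R, +oo[ (EFin \o gamma_density x).
Proof.
move=> /gamma_density_dominated[c c0 cP].
apply: le_integrable (integrable_exp_half c0) => //.
  by apply/measurable_EFinP; exact: measurable_gamma_density.
move=> t /=; rewrite in_itv/= andbT => t0.
rewrite lee_fin ger0_norm ?gamma_density_ge0// ger0_norm ?cP//.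
by rewrite mulr_ge0 ?expR_ge0.
Qed.

Lemma GammaE x : 1 <= x ->
  Gamma x = \int[mu]_(t in `[0%R, +oo[) gamma_density x t.
Proof.
move=> x1; rewrite /Gamma Rintegral_itv_obnd_cbnd//.
apply: integrableS (integrable_gamma_density x1) => //.
by apply: subset_itvr; rewrite bnd_simp.
Qed.

Lemma Gamma1 : Gamma (1 : R) = 1.
Proof.
rewrite GammaE//.
have cF : continuous (fun t : R => - expR (- t)).
  by move=> t; apply: differentiable_continuous; exact/derivable1_diffP.
rewrite (@Rintegral_ge0_continuous_FTC2y _ _ (fun t => - expR (- t)) _ 0)//.
- by rewrite oppr0 expR0 sub0r opprK.
- by move=> t _; exact: gamma_density_ge0.
- apply: continuous_subspaceT => t; rewrite /gamma_density.
  rewrite (_ : (fun _ => _) = (fun t => expR (- t))).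
    by apply: continuous_comp; [exact: cvgN|exact: continuous_expR].
  by apply/funext => s; rewrite subrr powRr0 mul1r.
- by rewrite -oppr0; apply: cvgN; exact: cvgr_expR.
- exact/cvg_at_right_filter/cF.
- move=> t _; rewrite derive1E derive_val /gamma_density subrr powRr0 mul1r.
  by rewrite mulrN1 opprK.
Qed.

Lemma powR_cvg_right x : 0 <= x -> t `^ x @[t --> 0^'+] --> (0 : R) `^ x.
Proof.
rewrite le_eqVlt => /predU1P[<-|x0].
  under eq_fun do rewrite powRr0.
  by rewrite powRr0; exact: cvg_cst.
by rewrite powR0 ?gt_eqF//; exact: powR_cvg0.
Qed.

Lemma expRN_cvg_right (c : R) : expR (- (c * t)) @[t --> 0^'+] --> expR (- (c * 0)).
Proof.
apply/cvg_at_right_filter.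
apply: (@continuous_comp _ _ _ (fun t => - (c * t)) expR); last exact: continuous_expR.
by apply: cvgN; apply: cvgMr; exact: cvg_id.
Qed.

(** Integration by parts, in one application of the fundamental theorem of
    calculus on the half line: that theorem asks for an integrand of constant
    sign, so a multiple of exp(- t / 2) is added to the derivative of
    t^x exp(- t) to make it nonnegative, and its integral is subtracted at the
    end. *)
Lemma Gamma_succ x : 1 <= x -> Gamma (x + 1) = x * Gamma x.
Proof.
move=> x1; have x0 : 0 < x by exact: lt_le_trans x1.
have x1' : 1 <= x + 1 by rewrite ler_wpDl// ltW.
have [c c0 cP] := gamma_density_dominated x1'.
pose f t := x * gamma_density x t - gamma_density (x + 1) t + c * expR (- (2^-1 * t)).
have fint : \int[mu]_(t in `[0%R, +oo[) f t = 2 * c.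
  rewrite (@Rintegral_ge0_continuous_FTC2y _ _
    (fun t => t `^ x * expR (- (1 * t)) - 2 * c * expR (- (2^-1 * t))) _ 0)//.
  - by rewrite powR0 ?gt_eqF// mul0r !mulr0 oppr0 expR0 mulr1 !sub0r opprK.
  - move=> t t0; rewrite /f -addrA addr_ge0//.
      by rewrite mulr_ge0 ?gamma_density_ge0// ltW.
    by rewrite addrC subr_ge0 cP.
  - apply/continuous_within_itvcyP; split => [t|].
      rewrite in_itv/= andbT => t0.
      apply: differentiable_continuous; apply/derivable1_diffP.
      rewrite /f /gamma_density; have ? := @is_derive1_powR R (x - 1) t t0; have ? := @is_derive1_powR R (x + 1 - 1) t t0.
      exact: ex_derive.
    rewrite /f /gamma_density.
    apply: cvgD; last by apply: cvgMr; exact: expRN_cvg_right.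
    apply: cvgB.
      apply: cvgMr; apply: cvgM; first by apply: powR_cvg_right; rewrite subr_ge0.
      by have := @expRN_cvg_right 1; under eq_fun do rewrite mul1r; rewrite mul1r.
    apply: cvgM; first by apply: powR_cvg_right; rewrite addrK ltW.
    by have := @expRN_cvg_right 1; under eq_fun do rewrite mul1r; rewrite mul1r.
  - rewrite -[X in _ --> X](subr0 0); apply: cvgB; last exact: exp_half_cvg.
    apply: (@squeeze_cvgr _ _ _ _ (cst 0) (fun t => c * expR (- (2^-1 * t)))).
    + near=> t; rewrite mulr_ge0 ?powR_ge0 ?expR_ge0//=.
      have := cP t; rewrite /gamma_density addrK mul1r; apply.
      by near: t; exact: nbhs_pinfty_ge.
    + exact: cvg_cst.
    + exact: exp_half_cvg.
  - by move=> t t0; have ? := @is_derive1_powR R x t t0; exact: ex_derive.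
  - apply: cvgB; last by apply: cvgMr; exact: expRN_cvg_right.
    by apply: cvgM; [exact/powR_cvg_right/ltW|exact: expRN_cvg_right].
  - move=> t; rewrite in_itv/= andbT => t0.
    rewrite derive1E; apply: derive_val.
    have ? := @is_derive1_powR R x t t0; apply: is_derive_eq.
    rewrite /f /gamma_density addrK /GRing.scale/= !mulr1 mul1r.
    by field.
have i1 := integrable_gamma_density x1; have i2 := integrable_gamma_density x1'.
have i3 := integrable_exp_half c0.
have i1' : mu.-integrable `[0, +oo[ (EFin \o (fun t => x * gamma_density x t)).
  by apply: eq_integrable (integrableZl _ x i1) => // t _; rewrite /= EFinM.
have e3 : \int[mu]_(t in `[0%R, +oo[) (c * expR (- (2^-1 * t))) = 2 * c.
  by rewrite /Rintegral exp_half_FTC.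
move: fint; rewrite /f RintegralD//; last first.
  by apply: eq_integrable (integrableB _ i1' i2) => // t _; rewrite /= EFinB.
rewrite RintegralB// RintegralZl// e3 -!GammaE//.
by move=> /eqP; rewrite -subr_eq0 addrK subr_eq0 => /eqP ->.
Unshelve. all: by end_near. Qed.

(** The tangent inequality for the concave function s |-> s^b at s = 1; it
    combines 1 + y <= exp y at y = - b ln s and at y = (1 - b) ln s, with
    weights 1 - b and b. *)
Lemma powR_bernoulli (s b : R) : 0 <= s -> 0 < b <= 1 ->
  s `^ b <= 1 - b + b * s.
Proof.
rewrite le_eqVlt => /predU1P[<-|s0] /andP[b0 b1].
  by rewrite powR0 ?gt_eqF// mulr0 addr0 subr_ge0.
set l := ln s; have es : s = expR l by rewrite lnK.
have -> : s `^ b = expR (b * l) by rewrite /powR gt_eqF.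
clearbody l; rewrite es -(ler_pM2l (expR_gt0 (- (b * l)))) -expRD addNr expR0.
have e1 := expR_ge1Dx (- (b * l)); have e2 := expR_ge1Dx ((1 - b) * l).
have e3 : expR (- (b * l)) * expR l = expR ((1 - b) * l).
  by rewrite -expRD; congr expR; ring.
rewrite mulrDr [X in _ <= _ + X]mulrCA e3.
have := @ler_wpM2l _ (1 - b) _ _ _ e1; have := @ler_wpM2l _ b _ _ _ e2.
by rewrite subr_ge0 b1 (ltW b0) => /(_ erefl) ? /(_ erefl) ?; nra.
Qed.

(** Integrate the tangent inequality t^b <= x^b (1 - b + b t / x) against the
    density of Gamma x; the mean of t / x is 1 by the functional equation, so
    the two corrections cancel. *)
Lemma Gamma_log_convex x b : 1 <= x -> 0 <= b <= 1 ->
  Gamma (x + b) <= x `^ b * Gamma x.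
Proof.
move=> x1 /andP[]; rewrite le_eqVlt => /predU1P[<- _|b0 b1].
  by rewrite addr0 powRr0 mul1r.
have x0 : 0 < x by exact: lt_le_trans x1.
have xb1 : 1 <= x + b by rewrite (le_trans x1)// lerDl ltW.
have xS1 : 1 <= x + 1 by rewrite (le_trans x1)// lerDl.
have i0 := integrable_gamma_density x1.
have i1 := integrable_gamma_density xS1.
pose f1 t := x `^ b * (1 - b) * gamma_density x t.
pose f2 t := x `^ b * (b / x) * gamma_density (x + 1) t.
have i0' : mu.-integrable `[0, +oo[ (EFin \o f1).
  by apply: eq_integrable (integrableZl _ (x `^ b * (1 - b)) i0) => // t _; rewrite /= EFinM.
have i1' : mu.-integrable `[0, +oo[ (EFin \o f2).
  by apply: eq_integrable (integrableZl _ (x `^ b * (b / x)) i1) => // t _; rewrite /= EFinM.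
apply: (@le_trans _ _ (\int[mu]_(t in `[0%R, +oo[) (f1 t + f2 t))).
  rewrite GammaE//; apply: le_Rintegral => //.
  - exact: integrable_gamma_density.
  - by apply: eq_integrable (integrableD _ i0' i1') => // t _; rewrite /= EFinD.
  move=> t /=; rewrite in_itv/= andbT => t0.
  have -> : f1 t + f2 t = x `^ b * (1 - b + b * (t / x)) * gamma_density x t.
    rewrite /f1 /f2 /gamma_density addrK -(mulr_powRB1 t0 x0); field.
    by rewrite gt_eqF.
  have -> : gamma_density (x + b) t = t `^ b * gamma_density x t.
    rewrite /gamma_density (_ : x + b - 1 = b + (x - 1)); last by ring.
    rewrite powRD ?mulrA//; apply/implyP => /eqP h; exfalso; lra.
  rewrite ler_wpM2r ?gamma_density_ge0//.
  rewrite -[in leLHS](@divfK _ x _ t) ?gt_eqF// mulrC.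
  rewrite powRM ?divr_ge0// ?(ltW x0)// ler_wpM2l ?powR_ge0//.
  by apply: powR_bernoulli; rewrite ?b0// divr_ge0// ltW.
rewrite RintegralD// !RintegralZl// -!GammaE// Gamma_succ// le_eqVlt; apply/orP; left.
by apply/eqP; field; rewrite gt_eqF.
Qed.

Lemma Gamma_nat n : Gamma (n.+1%:R : R) = n`!%:R.
Proof.
elim: n => [|n IHn]; first by rewrite Gamma1 fact0.
by rewrite -[n.+2%:R]natr1 Gamma_succ ?ler1n// IHn factS natrM.
Qed.

(** [Gamma_log_convex] bounds a factorial from above by a multiple of
    Gamma x. *)
Lemma Gamma_gt0 x : 1 <= x -> 0 < Gamma x.
Proof.
move=> x1; have x0 : 0 < x by exact: lt_le_trans x1.
have [n nx] : exists n : nat, n.+1%:R <= x < n.+2%:R.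
  have h := Num.Theory.truncn_itv (ltW x0).
  exists (Num.truncn x).-1; rewrite prednK//.
  by rewrite -(ltr_nat R) -(ltrD2r 1) add0r natr1 (le_lt_trans x1)//; case/andP: h.
have /andP[n1 n2] := nx.
have := @Gamma_log_convex x (n.+2%:R - x) x1.
rewrite subrKC Gamma_nat => h.
have {}h := h ltac:(apply/andP; split; lra).
have : 0 < x `^ (n.+2%:R - x) * Gamma x.
  by apply: lt_le_trans h; rewrite ltr0n fact_gt0.
by rewrite pmulr_rgt0// powR_gt0.
Qed.

(** For a natural number a this is the binomial coefficient C(n + a, n). *)
Definition binom_prod (n : nat) (a : R) : R := \prod_(i < n) (1 + a / i.+1%:R).

Lemma binom_prod_ge0 n (a : R) : 0 <= a -> 0 <= binom_prod n a.
Proof. by move=> a0; apply: prodr_ge0 => i _; rewrite addr_ge0 ?divr_ge0. Qed.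

Lemma binom_prodS n a : binom_prod n.+1 a = binom_prod n a * (1 + a / n.+1%:R).
Proof. by rewrite /binom_prod big_ord_recr. Qed.

Lemma Gamma_binom_prod n (a : R) : 0 <= a ->
  Gamma (n.+1%:R + a) = n`!%:R * binom_prod n a * Gamma (a + 1).
Proof.
move=> a0; elim: n => [|n IHn].
  by rewrite /binom_prod big_ord0 fact0 !mul1r addrC.
rewrite -[n.+2%:R]natr1 addrAC (@Gamma_succ (n.+1%:R + a)); last by rewrite ler_wpDr// ler1n.
rewrite IHn binom_prodS factS natrM.
by field; rewrite addrC natr1 pnatr_eq0.
Qed.

Lemma cvg_1Ddiv (c : R) : 1 + c / n%:R @[n --> \oo] --> (1 : R).
Proof.
rewrite -[X in _ --> X]addr0; apply: cvgD; first exact: cvg_cst.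
rewrite -[X in _ --> X](mulr0 c); apply: cvgMr.
rewrite -(cvg_shiftS (fun n => n%:R^-1 : R)); exact: cvg_harmonic.
Qed.

(** For 0 <= a <= 1 the two inequalities
    Gamma(n + 1 + a) <= (n + 1)^a n! and
    (n + 1)! <= (n + 1 + a)^(1 - a) Gamma(n + 1 + a)
    squeeze the ratio between 1 - 1 / n and 1 + 1 / n; the functional equation
    carries the result from a to a + 1. *)
Lemma Gamma_asymp (a : R) : 0 <= a ->
  Gamma (n.+1%:R + a) / (n`!%:R * n%:R `^ a) @[n --> \oo] --> (1 : R).
Proof.
move=> a0.
have [k [b [-> /andP[b0 b1]]]] : exists k : nat, exists b, a = b + k%:R /\ 0 <= b <= 1.
  have /andP[h1 h2] := Num.Theory.truncn_itv a0.
  exists (Num.truncn a), (a - (Num.truncn a)%:R); split; first by rewrite subrK.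
  by rewrite subr_ge0 h1 lerBlDl natr1 ltW.
elim: k => [|k IHk]; last first.
  rewrite -[X in _ --> X]mulr1.
  apply: (cvg_trans _ (cvgM IHk (cvg_1Ddiv (1 + (b + k%:R))))).
  apply: near_eq_cvg; near=> n.
  have n0 : (0 < n%:R :> R) by rewrite ltr0n; near: n; exact: nbhs_infty_gt.
  have -> : b + k.+1%:R = b + k%:R + 1 by rewrite -natr1 addrA.
  have : 0 <= b + k%:R by rewrite addr_ge0.
  move: (b + k%:R) => c c0.
  rewrite [in RHS]addrA (@Gamma_succ (n.+1%:R + c)); last by rewrite ler_wpDr// ler1n.
  rewrite powRD; last by apply/implyP => _; rewrite gt_eqF.
  rewrite powRr1 ?ltW//= -[n.+1%:R]natr1; field.
  by rewrite !gt_eqF// ?powR_gt0// ltr0n fact_gt0.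
rewrite addr0; apply: (@squeeze_cvgr _ _ _ _ (fun n => 1 - 1 / n%:R) (fun n => 1 + 1 / n%:R)); last 2 first.
- by have := @cvg_1Ddiv (-1); under eq_fun do rewrite mulNr.
- exact: cvg_1Ddiv.
near=> n.
have n1 : (1 <= n%:R :> R) by rewrite ler1n; near: n; exact: nbhs_infty_gt.
have n0 : (0 < n%:R :> R) by exact: lt_le_trans n1.
have f0 : (0 < n`!%:R :> R) by rewrite ltr0n fact_gt0.
have p0 : 0 < n%:R `^ b by rewrite powR_gt0.
have N1 : 1 <= n.+1%:R :> R by rewrite ler1n.
have Nb1 : 1 <= n.+1%:R + b by rewrite ler_wpDr.
have b1' : 0 <= 1 - b by rewrite subr_ge0.
apply/andP; split.
  rewrite ler_pdivlMr ?mulr_gt0//.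
  have := @Gamma_log_convex _ (1 - b) Nb1 ltac:(apply/andP; split; lra).
  rewrite (_ : n.+1%:R + b + (1 - b) = n.+2%:R); last by rewrite -[n.+2%:R]natr1; ring.
  rewrite Gamma_nat factS natrM => h.
  have h2 : (n.+1%:R + b) `^ (1 - b) * n%:R `^ b <= n.+1%:R + b.
    have m0 : 0 < n.+1%:R + b by exact: lt_le_trans Nb1.
    have e : n.+1%:R + b = (n.+1%:R + b) `^ (1 - b) * (n.+1%:R + b) `^ b.
      by rewrite -powRD ?subrK ?powRr1 ?(ltW m0)//; apply/implyP; rewrite gt_eqF.
    rewrite [leRHS]e.
    apply: ler_wpM2l; first exact: powR_ge0.
    by rewrite ge0_ler_powR ?nnegrE//; rewrite -?natr1; lra.
  have q0 : 0 < (n.+1%:R + b) `^ (1 - b) by rewrite powR_gt0//; lra.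
  rewrite -(ler_pM2l q0); apply: le_trans h.
  have h3 : (1 - 1 / n%:R) * (n.+1%:R + b) <= n.+1%:R.
    rewrite -(ler_pM2r n0) mulrAC mulrBl divfK ?gt_eqF// -natr1.
    by rewrite -[leLHS]/((1 * n%:R - 1) * (n%:R + 1 + b)); nra.
  have h4 : 0 <= 1 - 1 / n%:R :> R by rewrite mul1r subr_ge0 invf_le1.
  have := ler_wpM2l h4 h2 => /le_trans /(_ h3) h5.
  have := ler_wpM2l (ltW f0) h5; rewrite [leRHS]mulrC; apply: le_trans.
  by rewrite le_eqVlt; apply/orP; left; apply/eqP; ring.
rewrite ler_pdivrMr ?mulr_gt0//.
have := @Gamma_log_convex _ b N1 ltac:(by apply/andP; split).
rewrite Gamma_nat => /le_trans; apply.
rewrite [leLHS]mulrC mulrCA ler_wpM2l ?(ltW f0)//.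
have -> : n.+1%:R = n%:R * (1 + 1 / n%:R) :> R.
  by rewrite mulrDr mulr1 mul1r divff ?gt_eqF// natr1.
have q1 : 1 <= 1 + 1 / n%:R :> R by rewrite lerDl divr_ge0.
rewrite powRM ?(ltW n0)//.
by rewrite mulrC ler_wpM2r ?(ltW p0)// ler1_powR.
Unshelve. all: by end_near. Qed.

(** The product formula of Gauss. *)
Lemma binom_prod_cvg (a : R) : 0 <= a ->
  binom_prod n a / n%:R `^ a @[n --> \oo] --> (Gamma (a + 1))^-1.
Proof.
move=> a0; have G0 : 0 < Gamma (a + 1) by apply: Gamma_gt0; rewrite lerDr.
rewrite -[X in _ --> X]mulr1.
have lim : (Gamma (a + 1))^-1 * (Gamma (n.+1%:R + a) / (n`!%:R * n%:R `^ a))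
    @[n --> \oo] --> (Gamma (a + 1))^-1 * 1 by apply: cvgMr; exact: Gamma_asymp.
apply: (cvg_trans _ lim).
apply: near_eq_cvg; near=> n.
have n0 : (0 < n%:R :> R) by rewrite ltr0n; near: n; exact: nbhs_infty_gt.
rewrite Gamma_binom_prod//; field.
by rewrite !gt_eqF// ?powR_gt0// ltr0n fact_gt0.
Unshelve. all: by end_near. Qed.

(** One step multiplies the sequence by
    (1 + a / (n + 1)) (1 - 1 / (n + 1))^a, which is at most
    exp(a / (n + 1)) exp(- a / (n + 1)) = 1.  The monotonicity makes a single
    index n dominate all later terms in [mittag_leffler_dominated]. *)
Lemma binom_prod_noninc (a : R) n : 0 <= a -> (0 < n)%N ->
  binom_prod n.+1 a / n.+1%:R `^ a <= binom_prod n a / n%:R `^ a.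
Proof.
move=> a0 n_gt0.
have n0 : (0 < n%:R :> R) by rewrite ltr0n.
have N0 : (0 < n.+1%:R :> R) by rewrite ltr0n.
have p0 : 0 < n%:R `^ a by rewrite powR_gt0.
have P0 : 0 < n.+1%:R `^ a by rewrite powR_gt0.
rewrite binom_prodS ler_pdivrMr// -mulrA ler_wpM2l ?binom_prod_ge0//.
rewrite [leRHS]mulrC ler_pdivlMr//.
have -> : n%:R = n.+1%:R * (n%:R / n.+1%:R) :> R by field; rewrite gt_eqF.
rewrite powRM ?(ltW N0) ?divr_ge0// [leLHS]mulrC -mulrA ler_piMr ?powR_ge0//.
have e1 : (n%:R / n.+1%:R) `^ a <= expR (- (a / n.+1%:R)).
  have -> : - (a / n.+1%:R) = - (1 / n.+1%:R) * a by field; rewrite gt_eqF.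
  rewrite expRM ge0_ler_powR ?nnegrE ?divr_ge0 ?expR_ge0//.
  apply: le_trans (expR_ge1Dx _); rewrite le_eqVlt; apply/orP; left; apply/eqP.
  by rewrite -natr1; field; rewrite natr1 gt_eqF.
rewrite mulrC; apply: le_trans (ler_pM _ _ (expR_ge1Dx (a / n.+1%:R)) e1) _.
- by rewrite addr_ge0 ?divr_ge0.
- exact: powR_ge0.
- by rewrite -expRD subrr expR0.
Qed.
End gamma.

(** * Alternating binomial series and dominated series *)

Section negative_binomial.
Context {R : realType}.
Implicit Types (x y z alpha : R).

Definition negbin_term (k : nat) z : R ^nat := fun j => 'C(j + k, k)%:R * z ^+ j.

(** Pascal's rule, summed. *)
Lemma negbin_telescope k z N :
  (1 - z) * series (negbin_term k.+1 z) N =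
  series (negbin_term k z) N - 'C(N + k, k.+1)%:R * z ^+ N.
Proof.
rewrite /series/=; elim: N => [|N IHN].
  by rewrite !big_geq// bin_small// mul0r subr0 mulr0.
rewrite !big_nat_recr//= mulrDr IHN /negbin_term addSn addnS.
rewrite [in RHS]binS binS natrD exprS; ring.
Qed.

Lemma negbin_is_cvg k x : 0 <= x < 1 -> cvgn (series (negbin_term k x)).
Proof.
move=> /andP[x0 x1].
have t0 i j : 0 <= negbin_term i x j by rewrite mulr_ge0 ?exprn_ge0.
apply: nondecreasing_is_cvgn; first exact: nondecreasing_series.
exists ((1 - x)^-1 ^+ k.+1) => _ [N _ <-].
have x1' : 0 < 1 - x by rewrite subr_gt0.
elim: k => [|k IHk].
  have -> : negbin_term 0 x = geometric 1 x.
    by apply/funext => j; rewrite /negbin_term bin0.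
  rewrite geometric_seriesE ?lt_eqF//= mul1r expr1 ler_piMl ?invr_ge0 ?(ltW x1')//.
  by rewrite gerBl exprn_ge0.
rewrite exprS ler_pdivlMl// negbin_telescope (le_trans _ IHk)//.
by rewrite gerBl mulr_ge0 ?exprn_ge0.
Qed.

Lemma negbin_cvg k z : `|z| < 1 ->
  series (negbin_term k z) @ \oo --> (1 - z)^-1 ^+ k.+1.
Proof.
move=> z1; have z1' : 1 - z != 0.
  by rewrite subr_eq0; apply: contraTneq z1 => <-; rewrite normr1 ltxx.
elim: k => [|k IHk].
  have -> : negbin_term 0 z = geometric 1 z.
    by apply/funext => j; rewrite /negbin_term bin0.
  by rewrite expr1 -[X in _ --> X]mul1r; exact: cvg_geometric_series.
have bnd : 'C(N + k, k.+1)%:R * z ^+ N @[N --> \oo] --> 0.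
  apply/norm_cvg0P.
  apply: (@squeeze_cvgr _ _ _ _ (cst 0) (negbin_term k.+1 `|z|)).
  - near=> N; rewrite normr_ge0/= normrM normrX ger0_norm//.
    rewrite /negbin_term ler_wpM2r ?exprn_ge0// ler_nat.
    by apply: leq_bin2l; rewrite leq_add2l.
  - exact: cvg_cst.
  - by apply: cvg_series_cvg_0; apply: negbin_is_cvg; rewrite normr_ge0.
have -> : series (negbin_term k.+1 z) = fun N => (1 - z)^-1 *
    (series (negbin_term k z) N - 'C(N + k, k.+1)%:R * z ^+ N).
  by apply/funext => N; rewrite -negbin_telescope mulKf.
rewrite exprS; apply: cvgMr; rewrite -[X in _ --> X]subr0.
exact: cvgB.
Unshelve. all: by end_near. Qed.

(** Induction on n, from the identity
      (1 + j alpha / N) C(j + k, k) =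
        (1 - alpha (k + 1) / N) C(j + k, k)
        + (alpha (k + 1) / N) C(j + k + 1, k + 1),   N = n + 1.
    Both coefficients are nonnegative because alpha <= 1 and k + 1 <= N: this is
    where the restriction on the order enters. *)
Lemma binom_prod_newton alpha n : 0 <= alpha <= 1 ->
  exists2 p : nat -> R, (forall k, (k <= n)%N -> 0 <= p k) &
    forall j, binom_prod n (j%:R * alpha) = \sum_(k < n.+1) p k * 'C(j + k, k)%:R.
Proof.
move=> /andP[al0 al1]; elim: n => [|n [p p0 pE]].
  exists (fun=> 1) => // j; rewrite big_ord_recl big_ord0 bin0 mulr1 addr0.
  by rewrite /binom_prod big_ord0.
(* c k is the share of the k-th binomial that moves up to index k + 1. *)
pose c k : R := alpha * k.+1%:R / n.+1%:R.
exists (fun k => (if (k <= n)%N then (1 - c k) * p k else 0) +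
                 (if k is k'.+1 then c k' * p k' else 0)).
  move=> k kn; rewrite addr_ge0//.
    case: ifPn => // kn'; rewrite mulr_ge0 ?p0// subr_ge0 ler_pdivrMr ?mul1r//.
    by rewrite (le_trans (ler_piMl _ al1))// ler_nat.
  by case: k kn => // k kn; rewrite mulr_ge0 ?p0// !mulr_ge0.
move=> j; rewrite binom_prodS pE mulr_suml.
under [RHS]eq_bigr do rewrite mulrDl.
rewrite [RHS]big_split/= [X in _ = X + _]big_ord_recr/= ltnn mul0r addr0.
rewrite [X in _ = _ + X]big_ord_recl/= mul0r add0r -big_split/=.
apply: eq_bigr => -[k kn] _ /=; rewrite -ltnS kn /bump/= add1n.
have e : k.+1%:R * 'C(j + k.+1, k.+1)%:R = (j%:R + k%:R + 1) * 'C(j + k, k)%:R :> R.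
  by rewrite -natrM addnS -mul_bin_diag natrM -natr1 natrD.
have e' : 'C(j + k.+1, k.+1)%:R = (j%:R + k%:R + 1) * 'C(j + k, k)%:R / k.+1%:R :> R.
  by rewrite -e mulrC mulKf// pnatr_eq0.
rewrite e' /c -!natr1; field.
by rewrite !natr1 !pnatr_eq0.
Qed.

Lemma series_binom_prod (a : nat -> R) (p : nat -> R) n z :
  (forall j, a j = \sum_(k < n.+1) p k * 'C(j + k, k)%:R) ->
  series (fun j => a j * z ^+ j) =
  (fun N => \sum_(k < n.+1) p k * series (negbin_term k z) N).
Proof.
move=> aE; apply/funext => N; rewrite /series/=.
under [RHS]eq_bigr do rewrite mulr_sumr.
rewrite exchange_big/=; apply: eq_bigr => j _.
by rewrite aE mulr_suml; apply: eq_bigr => k _; rewrite mulrA.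
Qed.

(** The function Q is the combination of the powers (1 + x)^-(k + 1) given by
    [binom_prod_newton]. *)
Lemma relaxation_approx alpha n : 0 <= alpha <= 1 ->
  exists Q : R -> R, [/\
    forall x, 0 <= x < 1 ->
      series (fun j => binom_prod n (j%:R * alpha) * (- x) ^+ j) @ \oo --> Q x,
    forall x, 0 <= x -> 0 <= Q x &
    forall x y, 0 <= x <= y -> Q y <= Q x].
Proof.
move=> al01; have [p p0 pE] := binom_prod_newton n al01.
have pk (k : 'I_n.+1) : 0 <= p k by apply: p0; rewrite -ltnS ltn_ord.
exists (fun x => \sum_(k < n.+1) p k * (1 + x)^-1 ^+ k.+1); split.
- move=> x /andP[x0 x1]; rewrite (series_binom_prod _ pE).
  apply: cvg_big; first exact: add_continuous.
  move=> k _; apply: cvgMr; rewrite -[in X in _ --> X](opprK x).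
  by apply: negbin_cvg; rewrite normrN ger0_norm.
- move=> x x0; apply: sumr_ge0 => k _; rewrite mulr_ge0 ?pk//.
  by rewrite exprn_ge0// invr_ge0 addr_ge0.
- move=> x y /andP[x0 xy]; apply: ler_sum => k _.
  rewrite ler_wpM2l ?pk// lerXn2r ?nnegrE ?invr_ge0 ?addr_ge0//.
    exact: le_trans xy.
  by rewrite lef_pV2 ?posrE ?ltr_pwDl ?lerD2l//; exact: le_trans xy.
Qed.

Lemma binom_prod_series_cvg alpha n x : 0 <= alpha <= 1 -> 0 <= x < 1 ->
  cvgn (series (fun j => binom_prod n (j%:R * alpha) * x ^+ j)).
Proof.
move=> al01 /andP[x0 x1]; have [p p0 pE] := binom_prod_newton n al01.
rewrite (series_binom_prod _ pE).
apply/cvg_ex; exists (\sum_(k < n.+1) p k * (1 - x)^-1 ^+ k.+1).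
apply: cvg_big; first exact: add_continuous.
by move=> k _; apply: cvgMr; apply: negbin_cvg; rewrite ger0_norm.
Qed.

Lemma dominated_series_cvg (c M : R ^nat) :
  (forall j, `|c j| <= M j) -> cvgn (series M) -> cvgn (series c).
Proof.
move=> cM Mc; apply: normed_cvg; apply: series_le_cvg Mc => // j.
  exact: normr_ge0.
exact: le_trans (normr_ge0 _) (cM j).
Qed.

Lemma dominated_series_tail (c M : R ^nat) J :
  (forall j, (J <= j)%N -> `|c j| <= M j) ->
  cvgn (series c) -> cvgn (series M) ->
  `|limn (series c) - series c J| <= limn (series M) - series M J.
Proof.
move=> cM cc Mc.
have h1 : `|series c n - series c J| @[n --> \oo] --> `|limn (series c) - series c J|.
  by apply: cvg_norm; apply: cvgB => //; exact: cvg_cst.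
have h2 : series M n - series M J @[n --> \oo] --> limn (series M) - series M J.
  by apply: cvgB => //; exact: cvg_cst.
apply: (ler_cvg_to h1 h2); near=> n.
have Jn : (J <= n)%N by near: n; exact: nbhs_infty_ge.
rewrite !sub_series_geq//; apply: le_trans (ler_norm_sum _ _ _) _.
by rewrite ler_sum_nat// => j /andP[Jj _]; exact: cM.
Unshelve. all: by end_near. Qed.

(** Tannery's theorem: dominated convergence for series. *)
Lemma tannery (a : nat -> R ^nat) (b M : R ^nat) (N : nat) :
  (forall n j, (N <= n)%N -> `|a n j| <= M j) -> cvgn (series M) ->
  (forall j, a n j @[n --> \oo] --> b j) ->
  limn (series (a n)) @[n --> \oo] --> limn (series b).
Proof.
move=> aM Mc ab.
have bM j : `|b j| <= M j.
  apply: (@ler_cvg_to _ \oo _ _ (fun n => `|a n j|) (fun=> M j)).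
  - by apply: cvg_norm; exact: ab.
  - exact: cvg_cst.
  - by near=> n; apply: aM; near: n; exact: nbhs_infty_ge.
have bc := dominated_series_cvg bM Mc.
apply/cvgrPdist_le => e e0.
have e3 : 0 < e / 3 by rewrite divr_gt0.
(* Beyond J all the tails, of M and hence of b and of a n, are at most e / 3. *)
have [J _ JP] : \forall J \near \oo, `|limn (series M) - series M J| <= e / 3.
  by move/cvgrPdist_le : Mc => /(_ _ e3).
have {}JP := JP J (leqnn J).
have abJ : series (a n) J @[n --> \oo] --> series b J.
  apply: cvg_big; first exact: add_continuous.
  by move=> j _; exact: ab.
have abJ' : \forall n \near \oo, `|series b J - series (a n) J| <= e / 3.
  by move/cvgrPdist_le : abJ => /(_ _ e3).
near=> n.
have Nn : (N <= n)%N by near: n; exact: nbhs_infty_ge.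
have t1 := @dominated_series_tail b M J (fun j _ => bM j) bc Mc.
have anM j : `|a n j| <= M j by exact: aM.
have t2 := @dominated_series_tail (a n) M J (fun j _ => anM j) (dominated_series_cvg anM Mc) Mc.
have t3 : `|series b J - series (a n) J| <= e / 3 by near: n.
have t4 := le_trans (ler_norm _) JP.
move: t1 t2 t3; rewrite !ler_norml => /andP[? ?] /andP[? ?] /andP[? ?].
by apply/andP; split; lra.
Unshelve. all: by end_near. Qed.
End negative_binomial.

(** * The Mittag-Leffler function on the negative axis *)

Section mittag_leffler.
Context {R : realType} (alpha : R).
Hypotheses (alpha_gt0 : 0 < alpha) (alpha_le1 : alpha <= 1).
Implicit Types (x y z : R).

Let alpha01 : 0 <= alpha <= 1. Proof. by rewrite ltW. Qed.
Let al_ge0 j : 0 <= j%:R * alpha. Proof. by rewrite mulr_ge0// ltW. Qed.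
Let G_gt0 j : 0 < Gamma (j%:R * alpha + 1).
Proof. by apply: Gamma_gt0; rewrite lerDr. Qed.

Lemma binom_prod_noninc_le (a : R) N n : 0 <= a -> (0 < N <= n)%N ->
  binom_prod n a / n%:R `^ a <= binom_prod N a / N%:R `^ a.
Proof.
move=> a0 /andP[N0 Nn]; rewrite -(subnKC Nn); elim: (n - N)%N => [|k IHk].
  by rewrite addn0.
rewrite addnS (le_trans _ IHk)// binom_prod_noninc//.
by rewrite (leq_trans N0)// leq_addr.
Qed.

(** For n large the rescaled argument y / n^alpha lies in [0, 1), the domain
    on which the approximations converge. *)
Lemma powR_nat_gt y : \forall n \near \oo, y < n%:R `^ alpha.
Proof.
have y0 : 0 <= `|y| + 1 by rewrite addr_ge0.
near=> n.
have nM : (`|y| + 1) `^ alpha^-1 <= n%:R by near: n; exact: nbhs_infty_ger.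
have := @ge0_ler_powR R alpha (ltW alpha_gt0) _ _ _ _ nM.
rewrite !nnegrE powR_ge0 ler0n -powRrM mulVf ?gt_eqF// powRr1// => /(_ isT isT).
by apply: lt_le_trans; rewrite (le_lt_trans (ler_norm y))// ltrDl.
Unshelve. all: by end_near. Qed.

Let ptwise n j y : (0 < n)%N ->
  binom_prod n (j%:R * alpha) * (y / n%:R `^ alpha) ^+ j =
  binom_prod n (j%:R * alpha) / n%:R `^ (j%:R * alpha) * y ^+ j.
Proof.
move=> n0; have -> : n%:R `^ (j%:R * alpha) = (n%:R `^ alpha) ^+ j :> R.
  by rewrite mulrC powRrM powR_mulrn ?powR_ge0.
by rewrite expr_div_n; ring.
Qed.

Lemma mittag_leffler_dominated y : 0 <= y -> exists2 M : R ^nat,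
  cvgn (series M) & exists2 N : nat, (0 < N)%N &
  forall n j, (N <= n)%N ->
   binom_prod n (j%:R * alpha) / n%:R `^ (j%:R * alpha) * y ^+ j <= M j.
Proof.
move=> y0; have [N N0 yN] : exists2 N : nat, (0 < N)%N & y < N%:R `^ alpha.
  near \oo => N; exists N; last by near: N; exact: powR_nat_gt.
  by near: N; exact: nbhs_infty_gt.
have p0 : 0 < N%:R `^ alpha by rewrite powR_gt0// ltr0n.
(* By monotonicity in n the terms at N dominate; they are summable because
   y / N^alpha < 1. *)
exists (fun j => binom_prod N (j%:R * alpha) * (y / N%:R `^ alpha) ^+ j).
  apply: binom_prod_series_cvg => //.
  by rewrite divr_ge0 ?powR_ge0//= ltr_pdivrMr ?mul1r.
exists N => // n j Nn; rewrite ptwise// ler_wpM2r ?exprn_ge0//.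
by apply: binom_prod_noninc_le => //; rewrite N0.
Unshelve. all: by end_near. Qed.

Lemma mittag_leffler_approx y : 0 <= y ->
  limn (series (fun j => binom_prod n (j%:R * alpha) * (- (y / n%:R `^ alpha)) ^+ j))
    @[n --> \oo] --> mittag_leffler alpha (- y).
Proof.
move=> y0; have [M Mc [N N0 MN]] := mittag_leffler_dominated y0.
have aE n j : (0 < n)%N -> binom_prod n (j%:R * alpha) * (- (y / n%:R `^ alpha)) ^+ j =
  binom_prod n (j%:R * alpha) / n%:R `^ (j%:R * alpha) * (- y) ^+ j.
  by move=> n0; rewrite -mulNr ptwise.
apply: (@tannery _ _ _ M N) => //.
- move=> n j Nn; apply: le_trans (MN n j Nn).
  rewrite aE ?(leq_trans N0)// normrM normrX normrN (ger0_norm y0) ger0_norm//.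
  by rewrite divr_ge0 ?powR_ge0 ?binom_prod_ge0.
- move=> j; rewrite [X in _ --> X]mulrC.
  have lim : binom_prod n (j%:R * alpha) / n%:R `^ (j%:R * alpha) * (- y) ^+ j
     @[n --> \oo] --> (Gamma (j%:R * alpha + 1))^-1 * (- y) ^+ j.
    by apply: cvgMl; exact: binom_prod_cvg.
  apply: (cvg_trans _ lim); apply: near_eq_cvg; near=> n.
  by rewrite aE//; near: n; exact: nbhs_infty_gt.
Unshelve. all: by end_near. Qed.

Lemma mittag_leffler_series_cvg y : 0 <= y ->
  cvgn (series (fun j => y ^+ j / Gamma (j%:R * alpha + 1))).
Proof.
move=> y0; have [M Mc [N N0 MN]] := mittag_leffler_dominated y0.
apply: (@dominated_series_cvg _ _ M) => // j.
rewrite ger0_norm ?divr_ge0 ?exprn_ge0 ?(ltW (G_gt0 j))// mulrC.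
apply: le_trans (MN N j (leqnn N)); rewrite ler_wpM2r ?exprn_ge0//.
apply: (ler_cvg_to (binom_prod_cvg (al_ge0 j)) (cvg_cst _)).
near=> n; apply: binom_prod_noninc_le => //; rewrite N0/=.
by near: n; exact: nbhs_infty_ge.
Unshelve. all: by end_near. Qed.

Lemma mittag_leffler_ge0 y : 0 <= y -> 0 <= mittag_leffler alpha (- y).
Proof.
move=> y0; apply: (ler_cvg_to (cvg_cst 0) (mittag_leffler_approx y0)).
near=> n.
have [Q [QE Q0 _]] := relaxation_approx n alpha01.
have p0 : 0 < n%:R `^ alpha by near: n; exact: powR_nat_gt.
have yn : 0 <= y / n%:R `^ alpha < 1.
  rewrite divr_ge0 ?(ltW p0)//= ltr_pdivrMr// mul1r.
  by near: n; exact: powR_nat_gt.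
by rewrite (cvg_lim _ (QE _ yn))// Q0//; case/andP: yn.
Unshelve. all: by end_near. Qed.

Lemma mittag_leffler_noninc y z : 0 <= y <= z ->
  mittag_leffler alpha (- z) <= mittag_leffler alpha (- y).
Proof.
move=> /andP[y0 yz]; have z0 := le_trans y0 yz.
apply: (ler_cvg_to (mittag_leffler_approx z0) (mittag_leffler_approx y0)).
near=> n.
have [Q [QE _ Q1]] := relaxation_approx n alpha01.
have p0 : 0 < n%:R `^ alpha by near: n; exact: powR_nat_gt.
have zn : z / n%:R `^ alpha < 1.
  by rewrite ltr_pdivrMr// mul1r; near: n; exact: powR_nat_gt.
have yzn : 0 <= y / n%:R `^ alpha <= z / n%:R `^ alpha.
  by rewrite divr_ge0 ?(ltW p0)//= ler_wpM2r// invr_ge0 ltW.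
have /andP[yn0 yzn'] := yzn.
rewrite (cvg_lim _ (QE _ _)) ?(cvg_lim _ (QE _ _)) ?Q1//.
- by rewrite yn0 (le_lt_trans yzn').
- by rewrite (le_trans yn0).
Unshelve. all: by end_near. Qed.

(** Every term of index j >= 1 of the series at - y with 0 <= y <= 1 is at most
    y times the corresponding term at 1, in absolute value. *)
Lemma mittag_leffler_near0 : exists2 C : R, 0 <= C & forall y, 0 <= y <= 1 ->
  `|mittag_leffler alpha (- y) - 1| <= C * y.
Proof.
have c1 := mittag_leffler_series_cvg ler01.
exists (limn (series (fun j => 1 ^+ j / Gamma (j%:R * alpha + 1)))).
  apply: limr_ge => //; near=> n; apply: sumr_ge0 => j _.
  by rewrite divr_ge0 ?exprn_ge0 ?(ltW (G_gt0 j)).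
move=> y /andP[y0 y1].
have cy : cvgn (series (fun j => (- y) ^+ j / Gamma (j%:R * alpha + 1))).
  apply: (dominated_series_cvg _ (mittag_leffler_series_cvg y0)) => j.
  by rewrite normrM normrX normrN (ger0_norm y0) normfV gtr0_norm.
have cM := is_cvg_seriesZ (k := y) c1.
have := @dominated_series_tail _ _ _ 1%N _ cy cM.
rewrite lim_seriesZ// /mittag_leffler.
have s1 (v : R ^nat) : series v 1%N = v 0%N by rewrite /series/= big_nat1.
rewrite !s1 expr0 mul0r add0r Gamma1 divr1 => h.
apply: le_trans (h _) _.
  move=> [//|j] _; rewrite normrM normrX normrN (ger0_norm y0) normfV gtr0_norm//.
  rewrite -[leRHS]/(y * (1 ^+ j.+1 / _)) exprS expr1n -mulrA ler_wpM2l// ler_wpM2r ?invr_ge0 ?(ltW (G_gt0 _))//.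
  exact: exprn_ile1.
rewrite [leRHS]mulrC gerBl -[leRHS]/(y * (1 ^+ 0 / _)).
by rewrite mulr_ge0// divr_ge0// ltW.
Unshelve. all: by end_near. Qed.

Lemma mittag_leffler0 : mittag_leffler alpha 0 = 1.
Proof.
have [C C0 /(_ 0)] := mittag_leffler_near0.
by rewrite lexx ler01 oppr0 mulr0 normr_le0 subr_eq0 => /(_ isT)/eqP.
Qed.

End mittag_leffler.

(** * Primitives of weak derivatives *)

Section smooth_step.
Context {R : realType}.
Implicit Types (a b s t T : R) (n : nat).
Local Notation mu := (@lebesgue_measure R).

(** The piecewise linear bump supported on [0, 2] with integral 1, written with
    absolute values so that its primitive [smooth_step] is also given by one
    formula. *)
Definition tent t : R := (`|t| - 2 * `|t - 1| + `|t - 2|) / 2.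

Definition smooth_step t : R :=
  (t * `|t| - 2 * ((t - 1) * `|t - 1|) + (t - 2) * `|t - 2|) / 4.

(** This makes t * |t| the building block of the C^1 step below. *)
Lemma is_derive_mul_norm t : is_derive t 1 (fun t => t * `|t|) (2 * `|t|).
Proof.
have [t0|t0|->] := ltgtP t 0.
- apply: (@near_eq_is_derive _ _ _ (fun t => t * - t)).
    by near=> s; rewrite ltr0_norm//; near: s; exact: lt_nbhsl.
  by apply: is_derive_eq; rewrite ltr0_norm// /GRing.scale/=; ring.
- apply: (@near_eq_is_derive _ _ _ (fun t => t * t)).
    by near=> s; rewrite gtr0_norm//; near: s; exact: lt_nbhsr.
  by apply: is_derive_eq; rewrite gtr0_norm// /GRing.scale/=; ring.
- have lim : h^-1 *: ((((fun t : R => t * `|t|) \o shift 0) (h *: (1 : R))) - 0 * `|0 : R|)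
      @[h --> (0 : R)^'] --> (2 * `|0 : R| : R).
    rewrite normr0 !mulr0.
    have l0 : `|h| @[h --> (0 : R)^'] --> (0 : R).
      rewrite -[X in _ --> X](@normr0 _ R); apply: cvg_norm.
      exact: cvg_within.
    apply: (cvg_trans _ l0); apply: near_eq_cvg; near=> h.
    rewrite /= addr0 subr0 /GRing.scale/= mulr1 mulKf//.
    by near: h; exact: nbhs_dnbhs_neq.
  apply: DeriveDef; first by apply/cvg_ex; eexists; exact: lim.
  exact: (cvg_lim _ lim).
Unshelve. all: by end_near. Qed.

Lemma is_derive_smooth_step t : is_derive t 1 smooth_step (tent t).
Proof.
rewrite /smooth_step.
have d0 := is_derive_mul_norm t.
have d1 : is_derive t 1 (fun s => (s - 1) * `|s - 1|) (2 * `|t - 1|).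
  have dl : is_derive t 1 (fun s : R => s - 1) 1 by apply: is_derive_eq; rewrite subr0.
  have := @is_derive1_comp _ (fun t => t * `|t|) (fun s => s - 1) t _ _ (is_derive_mul_norm (t - 1)) dl.
  by rewrite mulr1.
have d2 : is_derive t 1 (fun s => (s - 2) * `|s - 2|) (2 * `|t - 2|).
  have dl : is_derive t 1 (fun s : R => s - 2) 1 by apply: is_derive_eq; rewrite subr0.
  have := @is_derive1_comp _ (fun t => t * `|t|) (fun s => s - 2) t _ _ (is_derive_mul_norm (t - 2)) dl.
  by rewrite mulr1.
by apply: is_derive_eq; rewrite /tent /GRing.scale/=; field.
Qed.

Lemma tent_continuous : continuous tent.
Proof.
have cn (c : R) : continuous (fun t : R => `|t - c|).
  move=> t; apply: cvg_norm.
  by apply: cvgB; [exact: cvg_id|exact: cvg_cst].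
move=> t; apply: cvgMl; apply: cvgD; last exact: cn.
by apply: cvgB; [exact: norm_continuous|apply: cvgMr; exact: cn].
Qed.

Lemma tent_ge0 t : 0 <= tent t.
Proof.
rewrite /tent divr_ge0//.
by case: (ger0P t); case: (ger0P (t - 1)); case: (ger0P (t - 2)) => *; lra.
Qed.

Lemma tent_eq0 t : ~ (0 <= t <= 2) -> tent t = 0.
Proof.
move=> h; rewrite /tent.
case: (ger0P t) h; case: (ger0P (t - 1)); case: (ger0P (t - 2)) => ? ? ? h; try lra.
Qed.

Lemma smooth_step_le0 t : t <= 0 -> smooth_step t = - 2^-1.
Proof.
by move=> t0; rewrite /smooth_step !ler0_norm; [field|lra..].
Qed.

Lemma smooth_step_ge2 t : 2 <= t -> smooth_step t = 2^-1.
Proof.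
by move=> t0; rewrite /smooth_step !ger0_norm; [field|lra..].
Qed.

Lemma smooth_step_bound t : `|smooth_step t| <= 2.
Proof.
have [t0|t0] := leP t 0.
  by rewrite smooth_step_le0// normrN ger0_norm//; lra.
have [t2|t2] := leP 2 t.
  by rewrite smooth_step_ge2// ger0_norm//; lra.
rewrite ler_norml /smooth_step.
by case: (ger0P t); case: (ger0P (t - 1)); case: (ger0P (t - 2)) => *; apply/andP; split; nra.
Qed.

Definition scaled_step a n t : R := smooth_step (n%:R * (t - a)).
Definition bump a n t : R := n%:R * tent (n%:R * (t - a)).

Lemma is_derive_scaled_step a n t : is_derive t 1 (scaled_step a n) (bump a n t).
Proof.
have dl : is_derive t 1 (fun s : R => n%:R * (s - a)) n%:R.
  by apply: is_derive_eq; rewrite subr0 /GRing.scale/= mulr1.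
have := @is_derive1_comp _ smooth_step (fun s => n%:R * (s - a)) t _ _
  (is_derive_smooth_step (n%:R * (t - a))) dl.
by rewrite mulrC.
Qed.

Lemma derivable_scaled_step a n t : derivable (scaled_step a n) t 1.
Proof. by case: (is_derive_scaled_step a n t). Qed.

Lemma bump_continuous a n : continuous (bump a n).
Proof.
move=> t; apply: cvgMr.
apply: (@continuous_comp _ _ _ (fun t => n%:R * (t - a)) tent); last exact: tent_continuous.
by apply: cvgMr; apply: cvgB; [exact: cvg_id|exact: cvg_cst].
Qed.

Lemma scaled_step_continuous a n : continuous (scaled_step a n).
Proof.
move=> t; apply: differentiable_continuous; apply/derivable1_diffP.
exact: derivable_scaled_step.
Qed.

Lemma Rintegral_itv_oo_cc (f : R -> R) a b :
  mu.-integrable `[a, b] (EFin \o f) ->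
  \int[mu]_(t in `]a, b[) f t = \int[mu]_(t in `[a, b]) f t.
Proof.
move=> fi; have foo : mu.-integrable `]a, b[ (EFin \o f).
  by apply: integrableS fi => //; exact: subset_itv_oo_cc.
rewrite Rintegral_itv_bndo_bndc// Rintegral_itv_obnd_cbnd//.
by apply: integrableS fi => //; exact: subset_itv_oc_cc.
Qed.

Lemma within_integrable T (f : R -> R) : {within `[0, T], continuous f} ->
  mu.-integrable `[0, T] (EFin \o f).
Proof. by move=> cf; apply: continuous_compact_integrable => //; exact: segment_compact. Qed.

(** The bumps are a unit mass concentrated on [a, a + 2 / n]. *)
Lemma integral_bump a n T : 0 < T -> 0 <= a -> 2 <= n%:R * (T - a) ->
  \int[mu]_(t in `[0, T]) bump a n t = 1.
Proof.
move=> T0 a0 nT.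
have cK : continuous _ := @bump_continuous a n.
rewrite /Rintegral (@continuous_FTC2 _ (bump a n) (scaled_step a n))//.
- rewrite /= /scaled_step smooth_step_ge2// smooth_step_le0; first by field.
  by rewrite sub0r mulrN oppr_le0 mulr_ge0.
- exact: continuous_subspaceT.
- split.
  + by move=> x _; exact: derivable_scaled_step.
  + exact/cvg_at_right_filter/scaled_step_continuous.
  + exact/cvg_at_left_filter/scaled_step_continuous.
- by move=> x _; rewrite derive1E; apply: derive_val; exact: is_derive_scaled_step.
Qed.

Lemma bump_approx_identity T (U : R -> R) a :
  {within `[0, T], continuous U} -> 0 < a < T ->
  \int[mu]_(t in `]0, T[) (U t * bump a n t) @[n --> \oo] --> U a.
Proof.
move=> cU /andP[a0 aT].
have T0 : 0 < T by exact: lt_trans aT.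
have cK n := @continuous_subspaceT _ _ `[0, T] _ (@bump_continuous a n).
have cUK n : {within `[0, T], continuous (fun t => U t * bump a n t)}.
  by move=> t; apply: cvgM; [exact: cU|exact: cK].
apply/cvgrPdist_le => e e0.
have Ua : {for a, continuous U}.
  by apply: (within_continuous_continuous T0 cU); rewrite in_itv/= a0.
move/cvgrPdist_le : Ua => /(_ _ e0)[d/= d0 dP].
near=> n.
have nd : 2 < n%:R * d.
  rewrite -ltr_pdivrMr//; near: n; exact: nbhs_infty_gtr.
have nT : 2 <= n%:R * (T - a).
  rewrite -ler_pdivrMr ?subr_gt0//; near: n; exact: nbhs_infty_ger.
rewrite Rintegral_itv_oo_cc; last exact: within_integrable.
rewrite -[X in `|X - _|]mulr1 -(integral_bump T0 (ltW a0) nT).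
have iK := within_integrable (cK n).
rewrite -RintegralZl// -RintegralB//; last 2 first.
  by apply: within_integrable => t; apply: cvgMr; exact: cK.
  exact: within_integrable.
have cD : {within `[0, T], continuous (fun t => U a * bump a n t - U t * bump a n t)}.
  by move=> t; apply: cvgB; [apply: cvgMr; exact: cK|exact: cUK].
apply: le_trans (le_normr_Rintegral _ _) _ => //; first exact: within_integrable.
rewrite -[leRHS]mulr1 -(integral_bump T0 (ltW a0) nT) -RintegralZl//.
apply: le_Rintegral => //.
- by apply: within_integrable => t; apply: cvg_norm; exact: cD.
- by apply: within_integrable => t; apply: cvgMr; exact: cK.
move=> t _; rewrite -mulrBl normrM [`|bump _ _ _|]ger0_norm; last first.
  by rewrite mulr_ge0// tent_ge0.
have [st|st] := pselect (0 <= n%:R * (t - a) <= 2); last first.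
  by rewrite /bump tent_eq0// !mulr0.
apply: ler_wpM2r; first by rewrite mulr_ge0// tent_ge0.
apply: dP; rewrite /ball_/=.
have n0 : (0 < n%:R :> R) by rewrite -(pmulr_lgt0 _ d0); exact: lt_trans nd.
move: st => /andP[s1 s2]; rewrite distrC ger0_norm; last by rewrite pmulr_rge0 in s1.
by rewrite -(ltr_pM2l n0) (le_lt_trans s2).
Unshelve. all: by end_near. Qed.

Lemma integrable_bounded_mul (D : set R) (h v : R -> R) (C : R) :
  measurable D -> mu.-integrable D (EFin \o v) -> measurable_fun D h ->
  (forall t, D t -> `|h t| <= C) ->
  mu.-integrable D (EFin \o (fun t => h t * v t)).
Proof.
move=> mD vi mh hC.
have hb : [bounded h x | x in D].
  exists C; split; first exact: num_real.
  by move=> M CM t /= Dt; rewrite (le_trans (hC t Dt))// ltW.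
by apply: (@eq_integrable _ _ _ mu D mD ((EFin \o h) \* (EFin \o v))%E);
  [move=> t _; rewrite /= EFinM|exact: integrableMr].
Qed.

(** On a bounded interval |v| <= 1 + v^2. *)
Lemma square_integrable_integrable T (v : R -> R) :
  square_integrable T v -> mu.-integrable `]0, T[ (EFin \o v).
Proof.
rewrite /square_integrable => vL; have v2 := Lfun2_integrable_sqr vL.
have mv : measurable_fun setT (v \_ `]0, T[).
  by move: vL; rewrite inE => /andP[]; rewrite inE.
have i1 : mu.-integrable `]0, T[ (EFin \o cst (1 : R)).
  apply: (@integrableS _ _ _ mu `[0, T]) => //; first exact: subset_itv_oo_cc.
  by apply: within_integrable; apply: continuous_subspaceT; exact: cst_continuous.
have i2 : mu.-integrable `]0, T[ (EFin \o (fun t => (v \_ `]0, T[) t ^+ 2)).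
  exact: integrableS v2.
have h : mu.-integrable `]0, T[ (EFin \o (v \_ `]0, T[)).
  apply: le_integrable (integrableD _ i1 i2) => //.
    by apply/measurable_EFinP; exact: measurable_funTS.
  move=> t Dt; rewrite /= lee_fin.
  set w := (v \_ _) t; rewrite [leRHS]ger0_norm; last by rewrite addr_ge0// sqr_ge0.
  rewrite -real_normK ?num_real//; have := normr_ge0 w; nra.
by apply: eq_integrable h => // t tD; rewrite /= patchE tD.
Qed.

Lemma integrable_itv_oo_cc T (v : R -> R) : 0 < T ->
  mu.-integrable `]0, T[ (EFin \o v) -> mu.-integrable `[0, T] (EFin \o v).
Proof.
move=> T0 /integrableP[mv vfin]; apply/integrableP.
have ccE : `[0, T]%classic = `]0, T[%classic `|` ([set 0] `|` [set T]) :> set R.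
  apply/seteqP; split => t /=; rewrite !in_itv/=.
    move=> /andP[]; rewrite le_eqVlt => /predU1P[<- _|t0]; first by right; left.
    by rewrite le_eqVlt => /predU1P[->|tT]; [right; right|left; rewrite t0].
  by move=> [/andP[/ltW-> /ltW->]//|[->|->]]; rewrite lexx ltW.
have mv' : measurable_fun `[0, T] (EFin \o v).
  rewrite ccE; apply/measurable_funU => //; first exact: measurableU.
  by split => //; apply/measurable_funU => //; split; exact: measurable_fun_set1.
split => //.
rewrite -integral_itv_obnd_cbnd; last first.
  apply: measurableT_comp => //; apply: measurable_funS mv' => //.
  exact: subset_itv_oc_cc.
by rewrite -integral_itv_bndo_bndc//; exact: measurableT_comp.
Qed.

Lemma is_derive_scaled_stepB a b n t :
  is_derive t 1 (fun t => scaled_step a n t - scaled_step b n t) (bump a n t - bump b n t).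
Proof.
have := is_derive_scaled_step a n t; have := is_derive_scaled_step b n t => *.
exact: is_deriveB.
Qed.

Lemma derive1_scaled_stepB a b n t :
  (fun t => scaled_step a n t - scaled_step b n t)^`()%classic t = bump a n t - bump b n t.
Proof. by rewrite derive1E; apply: derive_val; exact: is_derive_scaled_stepB. Qed.

(** A smoothed indicator of [a, b], supported in [a, b + 2 / n]. *)
Lemma bump_test_function T a b n : 0 < a <= b -> b < T -> 2 < n%:R * (T - b) ->
  test_function T (fun t => scaled_step a n t - scaled_step b n t).
Proof.
move=> /andP[a0 ab] bT nb.
have n0 : (0 < n%:R :> R).
  by rewrite -(@pmulr_lgt0 _ (T - b)) ?subr_gt0//; exact: lt_trans nb.
split.
- by move=> t; case: (is_derive_scaled_stepB a b n t).
- rewrite (_ : _^`()%classic = fun t => bump a n t - bump b n t); last first.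
    by apply/funext => t; exact: derive1_scaled_stepB.
  by move=> t; apply: cvgB; exact: bump_continuous.
- exists a, (b + 2 / n%:R); split => //.
    by rewrite -ltrBrDl ltr_pdivrMr// mulrC.
  move=> t h; have [ta|ta] := leP t a.
    rewrite /scaled_step !smooth_step_le0 ?subrr//.
      by rewrite pmulr_rle0// subr_le0 (le_trans ta).
    by rewrite pmulr_rle0// subr_le0.
  have tb : b + 2 / n%:R < t.
    by rewrite ltNge; apply/negP => tb; apply: h; rewrite (ltW ta).
  have tb' : 2 <= n%:R * (t - b).
    by rewrite mulrC -ler_pdivrMr// lerBrDl ltW.
  rewrite /scaled_step !smooth_step_ge2 ?subrr//.
  by apply: le_trans tb' _; rewrite ler_pM2l// lerB.
Qed.

(** The sequence is eventually constant at each t.  The half-open interval is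
    the right limit because the smoothing takes place to the right of a and of
    b. *)
Lemma scaled_stepB_cvg a b t : a <= b ->
  scaled_step a n t - scaled_step b n t @[n --> \oo] --> (\1_`]a, b] t : R).
Proof.
move=> ab; rewrite indicE.
have big (d : R) : 0 < d -> \forall n \near \oo, 2 <= n%:R * d.
  by move=> d0; near=> n; rewrite -ler_pdivrMr//; near: n; exact: nbhs_infty_ger.
apply: cvg_near_cst; have [ta|ta] := leP t a.
  rewrite memNset /=; last by rewrite in_itv/= ltNge ta.
  apply: nearW => n; rewrite /scaled_step !smooth_step_le0 ?subrr// mulr_ge0_le0// subr_le0//.
  exact: le_trans ab.
have [tb|tb] := leP t b.
  rewrite mem_set /=; last by rewrite in_itv/= ta.
  near=> n; rewrite /scaled_step [smooth_step (_ * (t - b))]smooth_step_le0.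
    rewrite smooth_step_ge2; first by field.
    by near: n; apply: big; rewrite subr_gt0.
  by rewrite mulr_ge0_le0// subr_le0.
rewrite memNset /=; last by rewrite in_itv/= ta leNgt tb.
near=> n; rewrite /scaled_step !smooth_step_ge2 ?subrr//.
  by near: n; apply: big; rewrite subr_gt0.
by near: n; apply: big; rewrite subr_gt0.
Unshelve. all: by end_near. Qed.

(** Test the definition of the weak derivative against the smoothed indicators
    of ]a, b]: on one side the derivatives of the test functions concentrate at a
    and at b, on the other side dominated convergence applies. *)
Lemma weak_derivative_interior T (U v : R -> R) a b :
  {within `[0, T], continuous U} -> mu.-integrable `]0, T[ (EFin \o v) ->
  is_weak_derivative T U v -> 0 < a <= b -> b < T ->
  U b - U a = \int[mu]_(t in `]a, b]) v t.
Proof.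
move=> cU vi Uv ab bT; have /andP[a0 aleb] := ab.
have b0 : 0 < b by exact: lt_le_trans aleb.
have aT : a < T by exact: le_lt_trans bT.
have T0 : 0 < T by exact: lt_trans bT.
pose phi n t := scaled_step a n t - scaled_step b n t.
have mphi n D : measurable_fun D (phi n).
  apply: measurable_funTS; apply: measurable_funB;
    by apply: continuous_measurable_fun; exact: scaled_step_continuous.
have phi4 n t : `|phi n t| <= 4.
  apply: le_trans (ler_normB _ _) _.
  by apply: le_trans (lerD (smooth_step_bound _) (smooth_step_bound _)) _; lra.
have lim1 : \int[mu]_(t in `]0, T[) (v t * phi n t) @[n --> \oo] -->
    \int[mu]_(t in `]a, b]) v t.
  have Dab : `]0, T[ `&` `]a, b] = `]a, b]%classic :> set R.
    apply/seteqP; split => [t [] //|t tab]; split => //.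
    move: tab; rewrite /= !in_itv/= => /andP[at_ tb].
    by rewrite (lt_trans a0 at_) (le_lt_trans tb bT).
  rewrite -Dab Rintegral_mkcondr.
  have mv : measurable_fun `]0, T[ (EFin \o v) by exact: measurable_int vi.
  have vpatch : v \_ `]a, b] = fun t => v t * \1_`]a, b] t.
    by apply/funext => t; rewrite patchE indicE; case: ifP; rewrite ?mulr1 ?mulr0.
  have mf n : measurable_fun `]0, T[ (fun t => (v t * phi n t)%:E).
    by apply/measurable_EFinP; apply: measurable_funM => //; exact/measurable_EFinP.
  have mlim : measurable_fun `]0, T[ (EFin \o (v \_ `]a, b])).
    rewrite vpatch; apply/measurable_EFinP; apply: measurable_funM => //.
    exact/measurable_EFinP.
  have ptlim : {ae mu, forall t, `]0, T[%classic t ->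
      (v t * phi n t)%:E @[n --> \oo] --> (EFin \o (v \_ `]a, b])) t}.
    apply: aeW => t _; apply: cvg_EFin; first exact: nearW.
    by rewrite /= vpatch; apply: cvgMr; exact: scaled_stepB_cvg.
  have ig : mu.-integrable `]0, T[ (fun t => 4%:E * `|(v t)%:E|)%E.
    by apply: integrableZl => //; exact: integrable_abse.
  have dom : {ae mu, forall t n, `]0, T[%classic t ->
      (`|(v t * phi n t)%:E| <= 4%:E * `|(v t)%:E|)%E}.
    apply: aeW => t n _; rewrite /= lee_fin normrM mulrC.
    by apply: ler_wpM2r => //; exact: normr_ge0.
  have mI : measurable (`]0, T[%classic : set R) by [].
  have [ci _ lim] := @dominated_convergence _ _ _ mu _ mI _ _ _ mf mlim ptlim ig dom.
  apply: fine_cvg; rewrite fineK//; exact: integrable_fin_num.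
have lim2 : \int[mu]_(t in `]0, T[) (U t * (phi n)^`()%classic t) @[n --> \oo] --> U a - U b.
  have iU c n : mu.-integrable `]0, T[ (EFin \o (fun t => U t * bump c n t)).
    apply: (@integrableS _ _ _ mu `[0, T]) => //; first exact: subset_itv_oo_cc.
    apply: within_integrable => t; apply: cvgM; first exact: cU.
    by apply: continuous_subspaceT; exact: bump_continuous.
  rewrite (_ : (fun n => _) = fun n => \int[mu]_(t in `]0, T[) (U t * bump a n t) -
       \int[mu]_(t in `]0, T[) (U t * bump b n t)); last first.
    apply/funext => n; rewrite -RintegralB//; apply: eq_Rintegral => t _.
    by rewrite derive1_scaled_stepB mulrBr.
  by apply: cvgB; apply: bump_approx_identity => //; apply/andP.
have e : \forall n \near \oo, \int[mu]_(t in `]0, T[) (U t * (phi n)^`()%classic t) =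
   - \int[mu]_(t in `]0, T[) (v t * phi n t).
  near=> n; apply: Uv; apply: bump_test_function => //.
  rewrite -ltr_pdivrMr ?subr_gt0//; near: n; exact: nbhs_infty_gtr.
pose I n := \int[mu]_(t in `]0, T[) (v t * phi n t).
have lim3 : - I n @[n --> \oo] --> U a - U b.
  apply: (cvg_trans _ lim2); apply: near_eq_cvg; near=> n.
  by near: n.
have lim4 : - I n @[n --> \oo] --> - \int[mu]_(t in `]a, b]) v t by exact: cvgN.
have eq34 : U a - U b = - \int[mu]_(t in `]a, b]) v t.
  by rewrite -(cvg_lim (@norm_hausdorff _ R) lim3); exact: (cvg_lim (@norm_hausdorff _ R) lim4).
by rewrite -opprB eq34 opprK.
Unshelve. all: by end_near. Qed.

Lemma Rintegral_itv_split T (v : R -> R) a b :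
  mu.-integrable `[0, T] (EFin \o v) -> 0 <= a <= b -> b <= T ->
  \int[mu]_(t in `[0, b]) v t - \int[mu]_(t in `[0, a]) v t = \int[mu]_(t in `]a, b]) v t.
Proof.
move=> vi /andP[a0 ab] bT; apply: Rintegral_itvB; rewrite ?bnd_simp//.
by apply: integrableS vi => //; apply: subset_itvl; rewrite bnd_simp.
Qed.

Lemma within_continuous_eq_interior T (D : R -> R) : 0 < T ->
  {within `[0, T], continuous D} ->
  (forall a b, 0 < a <= b -> b < T -> D a = D b) ->
  forall t, 0 <= t <= T -> D t = D 0.
Proof.
move=> T0 /(continuous_within_itvP _ T0)[_ cD0 cDT] Dab.
have h0 : 0 < T / 2 < T by rewrite divr_gt0//=; lra.
have /andP[h1 h2] := h0.
have Dh t : 0 < t < T -> D t = D (T / 2).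
  by move=> /andP[t0 tT]; have [ht|/ltW ht] := leP t (T / 2);
    [|apply/esym]; apply: Dab => //; apply/andP.
have cst_lim (F : set_system R) (FF : ProperFilter F) (l : R) :
    D x @[x --> F] --> l -> (\forall x \near F, D x = D (T / 2)) -> l = D (T / 2).
  move=> Dl Dc; apply: (cvg_unique (@norm_hausdorff _ R) Dl).
  exact: cvg_near_cst.
have D0 : D 0 = D (T / 2).
  apply: (cst_lim _ _ _ cD0); near=> x; apply: Dh; apply/andP; split; near: x.
    exact: nbhs_right_gt.
  exact: nbhs_right_lt.
have DT : D T = D (T / 2).
  apply: (cst_lim _ _ _ cDT); near=> x; apply: Dh; apply/andP; split; near: x.
    exact: nbhs_left_gt.
  exact: nbhs_left_lt.
move=> t /andP[]; rewrite le_eqVlt => /predU1P[<-//|t0].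
rewrite le_eqVlt => /predU1P[->|tT]; first by rewrite DT.
by rewrite D0 Dh// t0.
Unshelve. all: by end_near. Qed.

(** The difference between U and the primitive of v is constant on ]0, T[ by
    [weak_derivative_interior], and it is continuous up to the end points. *)
Lemma weak_derivative_primitive T (U v : R -> R) :
  0 < T -> {within `[0, T], continuous U} -> mu.-integrable `[0, T] (EFin \o v) ->
  is_weak_derivative T U v ->
  forall t, 0 <= t <= T -> U t - U 0 = \int[mu]_(s in `[0, t]) v s.
Proof.
move=> T0 cU vi Uv t t0T.
pose D t := U t - \int[mu]_(s in `[0, t]) v s.
have voo : mu.-integrable `]0, T[ (EFin \o v).
  by apply: integrableS vi => //; exact: subset_itv_oo_cc.
have cD : {within `[0, T], continuous D}.
  move=> x; apply: cvgB; first exact: cU.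
  exact: (parameterized_integral_continuous (ltW T0) vi).
have Dab a b : 0 < a <= b -> b < T -> D a = D b.
  move=> ab bT; have /andP[a0 ab'] := ab.
  have := weak_derivative_interior cU voo Uv ab bT.
  rewrite -(@Rintegral_itv_split T) ?(ltW a0) ?(ltW bT)// => e.
  apply/eqP; rewrite /D -subr_eq0; apply/eqP.
  rewrite (_ : _ - _ = (\int[mu]_(s in `[0, b]) v s - \int[mu]_(s in `[0, a]) v s) - (U b - U a)).
    by rewrite e subrr.
  ring.
have := within_continuous_eq_interior T0 cD Dab t0T.
rewrite /D set_itv1 Rintegral_set1 subr0 => <-; ring.
Qed.
End smooth_step.

(** * Integration against a monotone weight *)

Section monotone_weight.
Context {R : realType}.
Implicit Types (a b s t lo : R).
Local Notation mu := (@lebesgue_measure R).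

Lemma integrableD_EFin (D : set R) (f g : R -> R) : measurable D ->
  mu.-integrable D (EFin \o f) -> mu.-integrable D (EFin \o g) ->
  mu.-integrable D (EFin \o (fun t => f t + g t)).
Proof.
move=> mD fi gi; apply: (@eq_integrable _ _ _ mu D mD ((EFin \o f) \+ (EFin \o g))%E).
  by move=> t _; rewrite /= EFinD.
exact: integrableD.
Qed.

Lemma integrableB_EFin (D : set R) (v w : R -> R) : measurable D ->
  mu.-integrable D (EFin \o v) -> mu.-integrable D (EFin \o w) ->
  mu.-integrable D (EFin \o (fun t => v t - w t)).
Proof.
move=> mD vi wi; apply: (@eq_integrable _ _ _ mu D mD ((EFin \o v) \- (EFin \o w))%E).
  by move=> t _; rewrite /= EFinB.
exact: integrableB.
Qed.

(** Up to its end point, an upper set containing a cuts [0, b] in an interval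
    from some c <= a to b. *)
Lemma upper_set_tail (v : R -> R) (E : set R) a b lo :
  0 <= a <= b -> mu.-integrable `[0, b] (EFin \o v) ->
  (forall s, 0 <= s <= a -> lo <= \int[mu]_(t in `]s, b]) v t) ->
  E a -> (forall s t, s <= t -> E s -> E t) ->
  lo <= \int[mu]_(t in `[0, b] `&` E) v t.
Proof.
move=> /andP[a0 ab] vi lov Ea Eup.
pose c := inf (`[0, b] `&` E).
have Ha : (`[0, b] `&` E) a by split => //; rewrite /= in_itv/= a0.
have lb0 : lbound (`[0, b] `&` E) 0 by move=> x [] /=; rewrite in_itv/= => /andP[].
have hi : has_inf (`[0, b] `&` E) by split; [exists a | exists 0].
have ca : c <= a by exact: (ge_inf hi.2).
have c0 : 0 <= c by apply: lb_le_inf => //; exists a.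
have cb : c <= b by exact: le_trans ab.
have above t : c < t -> t <= b -> (`[0, b] `&` E) t.
  move=> ct tb; split; first by rewrite /= in_itv/= (le_trans c0 (ltW ct)).
  have tc : 0 < t - c by rewrite subr_gt0.
  have [s [_ Es] st] := inf_adherent tc hi.
  by apply: Eup Es; rewrite ltW// (lt_le_trans st)// subrKC.
have c0a : 0 <= c <= a by rewrite c0.
have lov' := lov c c0a.
have [Ec|Ec] := pselect (E c).
  have -> : `[0, b] `&` E = `[c, b]%classic :> set R.
    apply/seteqP; split => t /=.
      move=> tE; rewrite in_itv/=; apply/andP; split; first exact: (ge_inf hi.2).
      by case: tE => /=; rewrite in_itv/= => /andP[].
    rewrite in_itv/= le_eqVlt => /andP[/predU1P[<-|ct] tb]; last exact: above.
    by split => //; rewrite /= in_itv/= c0.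
  rewrite -Rintegral_itv_obnd_cbnd//; apply: integrableS vi => //.
  by apply: subset_itv; rewrite bnd_simp.
suff -> : `[0, b] `&` E = `]c, b]%classic :> set R by [].
apply/seteqP; split => t /=; last by rewrite in_itv/= => /andP[]; exact: above.
move=> tE; rewrite in_itv/=; apply/andP; split.
  rewrite lt_neqAle; apply/andP; split; last exact: (ge_inf hi.2).
  by apply/negP => /eqP ct; apply: Ec; rewrite ct; case: tE.
by case: tE => /=; rewrite in_itv/= => /andP[].
Qed.

Lemma Rintegral_sum_ord (D : set R) M (F : nat -> R -> R) : measurable D ->
  (forall l, mu.-integrable D (EFin \o F l)) ->
  mu.-integrable D (EFin \o (fun t => \sum_(l < M) F l t)) /\
  \int[mu]_(t in D) \sum_(l < M) F l t = \sum_(l < M) \int[mu]_(t in D) F l t.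
Proof.
move=> mD Fi; elim: M => [|M [IHi IH]].
  have -> : (fun t => \sum_(l < 0) F l t) = cst 0.
    by apply/funext => t; rewrite big_ord0.
  by split; [exact: integrable0|rewrite big_ord0 Rintegral_cst// mul0r].
have -> : (fun t => \sum_(l < M.+1) F l t) = (fun t => \sum_(l < M) F l t + F M t).
  by apply/funext => t; rewrite big_ord_recr.
split; last by rewrite RintegralD// IH big_ord_recr.
exact: integrableD_EFin.
Qed.

(** The sum is the integral part of y, as the number of positive integers up to
    y. *)
Lemma floor_count (M : nat) (y : R) : 0 <= y -> y < M.+1%:R ->
  0 <= y - \sum_(l < M) (l.+1%:R <= y)%R%:R <= 1.
Proof.
move=> y0; elim: M => [|M IH] yM.
  by rewrite big_ord0 subr0 y0 ltW.
rewrite big_ord_recr/=; have [My|My] := leP M.+1%:R y; last first.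
  by rewrite addr0; exact: IH.
have -> : \sum_(l < M) (l.+1%:R <= y)%R%:R = M%:R :> R.
  rewrite (eq_bigr (fun=> 1)).
    by rewrite sumr_const card_ord.
  move=> l _; rewrite (le_trans _ My)// ler_nat ltnS ltnW//.
rewrite natr1; move: My yM; rewrite -[M.+2%:R]natr1; lra.
Qed.

Lemma floor_slack (x m lo S J C : R) : m <= x -> x < m + 1 ->
  m * lo <= S -> S <= J + C -> lo * x <= J + (`|lo| + C).
Proof.
move=> mx xm mS SJ.
have : lo * (x - m) <= `|lo|.
  rewrite (le_trans (ler_norm _))// normrM ler_piMr//.
  by rewrite ger0_norm ?subr_ge0// lerBlDl ltW.
rewrite mulrBr [lo * m]mulrC; lra.
Qed.

(** Second mean value theorem, as an inequality.  Since q is maximal at a, it is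
    constant from a on.  Slice q by its level sets: q is, within 1 / n, the mean of
    n indicators of upper sets, those of the levels l / n with l <= n * q a.  Each
    of these sets contains a, so the integral of v over it is at least lo, and the
    slices number n * q a up to 1. *)
Lemma monotone_weight_le (v q : R -> R) a b lo :
  0 <= a <= b -> mu.-integrable `[0, b] (EFin \o v) ->
  (forall s, 0 <= s <= a -> lo <= \int[mu]_(t in `]s, b]) v t) ->
  {homo q : s t / s <= t} -> (forall s, 0 <= q s <= q a) ->
  lo * q a <= \int[mu]_(t in `[0, b]) (q t * v t).
Proof.
move=> ab vi lov qinc q01; have /andP[a0 aleb] := ab.
have mI : measurable (`[0, b]%classic : set R) by [].
have mq : measurable_fun `[0, b] q by exact: nondecreasing_measurable.
have qbnd t : `|q t| <= q a by rewrite ger0_norm; case/andP: (q01 t).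
have qvi : mu.-integrable `[0, b] (EFin \o (fun t => q t * v t)).
  by apply: (integrable_bounded_mul mI vi mq) => t _; exact: qbnd.
have vni := integrable_norm vi.
set C := \int[mu]_(t in `[0, b]) `|v t|.
suff key (N : nat) : lo * q a <= \int[mu]_(t in `[0, b]) (q t * v t) + (`|lo| + C) / N.+1%:R.
  have lim : \int[mu]_(t in `[0, b]) (q t * v t) + (`|lo| + C) / N.+1%:R @[N --> \oo] -->
      \int[mu]_(t in `[0, b]) (q t * v t).
    rewrite -[X in _ --> X]addr0; apply: cvgD; first exact: cvg_cst.
    by rewrite -[X in _ --> X](mulr0 (`|lo| + C)); apply: cvgMr; exact: cvg_harmonic.
  by apply: (ler_cvg_to (cvg_cst _) lim); exact: nearW.
set n : R := N.+1%:R.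
have n0 : 0 < n by rewrite ltr0n.
have nq0 s : 0 <= n * q s by rewrite mulr_ge0 ?(ltW n0)//; case/andP: (q01 s).
have /andP[M1 M2] := Num.Theory.truncn_itv (nq0 a).
set M := Num.truncn (n * q a) in M1 M2.
(* F l is v restricted to the level set of q above (l + 1) / n. *)
pose F l t : R := (l.+1%:R <= n * q t)%R%:R * v t.
have Fi l : mu.-integrable `[0, b] (EFin \o F l).
  apply: (@integrable_bounded_mul _ _ (fun t => (l.+1%:R <= n * q t)%R%:R) _ 1) => //.
    apply: nondecreasing_measurable => // s t st; rewrite ler_nat.
    case: (leP l.+1%:R (n * q s)) => // h.
    by rewrite (le_trans h)// ler_wpM2l ?(ltW n0)// qinc.
  by move=> t _; case: (l.+1%:R <= n * q t); rewrite ?normr1 ?normr0.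
have [Fsi Fs] := @Rintegral_sum_ord _ M F mI Fi.
have Flo l : (l < M)%N -> lo <= \int[mu]_(t in `[0, b]) F l t.
  move=> lM; pose E := [set t | l.+1%:R <= n * q t].
  have -> : \int[mu]_(t in `[0, b]) F l t = \int[mu]_(t in `[0, b] `&` E) v t.
    rewrite Rintegral_mkcondr; apply: eq_Rintegral => t _; rewrite patchE /F.
    case: ifPn => [/set_mem|/negP]; rewrite /E /=; first by move=> ->; rewrite mul1r.
    by move=> h; case: leP => h'; [exfalso; apply: h; rewrite inE|rewrite mul0r].
  apply: (@upper_set_tail _ _ a) => //.
    by rewrite /E /= (le_trans _ M1)// ler_nat.
  by move=> s t st; rewrite /E /= => /le_trans; apply; rewrite ler_wpM2l ?(ltW n0)// qinc.
have sumlo : M%:R * lo <= \int[mu]_(t in `[0, b]) \sum_(l < M) F l t.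
  rewrite Fs -[X in X%:R * _]card_ord mulr_natl -sumr_const.
  by apply: ler_sum => l _; exact: Flo.
have nqi : mu.-integrable `[0, b] (EFin \o (fun t => n * (q t * v t))).
  by apply: (integrable_bounded_mul mI qvi) => // t _; exact: lexx.
have err : \int[mu]_(t in `[0, b]) \sum_(l < M) F l t <=
    n * (\int[mu]_(t in `[0, b]) (q t * v t)) + C.
  rewrite -RintegralZl// -RintegralD//.
  apply: le_Rintegral => //.
    exact: integrableD_EFin.
  move=> t _; rewrite /F -mulr_suml.
  have nqt : n * q t < M.+1%:R.
    by apply: le_lt_trans M2; rewrite ler_wpM2l ?(ltW n0)//; case/andP: (q01 t).
  have /andP[] := floor_count (nq0 t) nqt.
  set S := \sum_(l < M) _ => S0 S1.
  rewrite -subr_ge0 [X in 0 <= X](_ : _ = (n * q t - S) * v t + `|v t|); last by ring.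
  have := ler_norm (- v t); rewrite normrN; have := normr_ge0 (v t); nra.
rewrite -(ler_pM2l n0) mulrDr [n * (_ / _)]mulrC divfK ?gt_eqF//.
rewrite -natr1 in M2; rewrite mulrCA.
exact: (floor_slack M1 M2 sumlo err).
Qed.
End monotone_weight.

(** * A comparison principle for convolutions with a nonincreasing kernel *)

Section comparison.
Context {R : realType}.
Implicit Types (a b s t T : R).
Local Notation mu := (@lebesgue_measure R).

(** A set of full measure is dense. *)
Lemma ae_exists_itv (P : R -> Prop) a b : {ae mu, forall t, P t} -> a < b ->
  exists2 t, a < t < b & P t.
Proof.
move=> aeP ab; apply: contrapT => nP.
have : mu.-negligible `]a, b[.
  apply: negligibleS aeP => t /=; rewrite in_itv/= => tab Pt.
  by apply: nP; exists t.
have mI : measurable (`]a, b[%classic : set R) by [].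
move=> /(iffLR (negligibleP mu mI)) /=; rewrite lebesgue_measure_itv/= lte_fin ab.
by move/eqP; rewrite -EFinB eqe subr_eq0 gt_eqF.
Qed.

Section volterra.
Variables (T kappa delta : R) (k m w : R -> R).
Hypotheses (k01 : forall t, 0 <= k t <= 1) (k0 : k 0 = 1).
Hypothesis kinc : forall s t, s <= t -> k t <= k s.
Hypotheses (delta_gt0 : 0 < delta) (kappa_ge0 : 0 <= kappa).
Hypothesis kdelta : kappa < k delta.
Hypothesis mcont : {within `[0, T], continuous m}.
Hypothesis wi : mu.-integrable `[0, T] (EFin \o w).
Hypothesis mw : forall t, 0 <= t <= T -> m t - m 0 = \int[mu]_(s in `[0, t]) w s.
Hypothesis mineq : {ae mu, forall t, 0 <= t <= T -> 0 < m t ->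
  \int[mu]_(s in `[0, t]) (k (t - s) * w s) <= kappa * m t}.

(** Split the weight q s = k (t - s) at its value at a, as
    q = min(q, q a) + max(q - q a, 0).  The first part increases only on [0, a],
    where m s <= 0, so every tail m t - m s of the integral of w from s is at least
    m t.  The second part has total increase at most 1, and there the tails are at
    least - e. *)
Lemma convolution_lower_bound a t e : 0 <= a <= t -> t <= T -> 0 <= e -> 0 < m t ->
  (forall s, 0 <= s <= a -> m s <= 0) ->
  (forall s, a <= s <= t -> m s <= m t + e) ->
  k (t - a) * m t - e <= \int[mu]_(s in `[0, t]) (k (t - s) * w s).
Proof.
move=> /andP[a0 at_] tT e0 mt0 ma mt.
have t0 : 0 <= t by exact: le_trans at_.
have mI : measurable (`[0, t]%classic : set R) by [].
have wit : mu.-integrable `[0, t] (EFin \o w).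
  by apply: integrableS wi => //; apply: subset_itvl; rewrite bnd_simp.
have tail s : 0 <= s <= t -> \int[mu]_(x in `]s, t]) w x = m t - m s.
  move=> /andP[s0 st].
  rewrite -(Rintegral_itv_split wi)//; last by rewrite s0.
  rewrite -!mw ?s0 ?t0 ?(le_trans st)//; ring.
pose q s := k (t - s).
have qinc : {homo q : x y / x <= y} by move=> x y xy; apply: kinc; rewrite lerD2l lerN2.
pose q1 s := Num.min (q s) (q a).
pose q2 s := Num.max (q s - q a) 0.
have q12 s : q s = q1 s + q2 s.
  rewrite /q1 /q2; case: (leP (q s) (q a)) => h.
    by rewrite max_r ?addr0// subr_le0.
  by rewrite max_l ?subrKC// subr_ge0 ltW.
have q1inc : {homo q1 : x y / x <= y}.
  by move=> x y /qinc xy; rewrite /q1 le_min2.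
have q2inc : {homo q2 : x y / x <= y}.
  by move=> x y /qinc xy; rewrite /q2 le_max2// lerB.
have q1a : q1 a = q a by rewrite /q1 minxx.
have qt : q t = 1 by rewrite /q subrr.
have q2t : q2 t = 1 - q a by rewrite /q2 qt max_l// subr_ge0; case/andP: (k01 (t - a)).
have q101 s : 0 <= q1 s <= q1 a.
  rewrite q1a /q1 ge_min lexx orbT andbT le_min /q.
  by have /andP[-> _] := k01 (t - s); have /andP[-> _] := k01 (t - a).
have q201 s : 0 <= q2 s <= q2 t.
  rewrite q2t /q2 le_max lexx orbT/= ge_max lerD2r.
  have /andP[_ ->] := k01 (t - s); rewrite subr_ge0.
  by have /andP[_ ->] := k01 (t - a).
have mq (p : R -> R) : {homo p : x y / x <= y} -> measurable_fun `[0, t] p.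
  by move=> pinc; exact: nondecreasing_measurable.
have i1 : mu.-integrable `[0, t] (EFin \o (fun s => q1 s * w s)).
  apply: (@integrable_bounded_mul _ _ _ _ (q1 a)) => //; first exact: mq.
  by move=> s _; rewrite ger0_norm; case/andP: (q101 s).
have i2 : mu.-integrable `[0, t] (EFin \o (fun s => q2 s * w s)).
  apply: (@integrable_bounded_mul _ _ _ _ (q2 t)) => //; first exact: mq.
  by move=> s _; rewrite ger0_norm; case/andP: (q201 s).
have -> : \int[mu]_(s in `[0, t]) (k (t - s) * w s) =
    \int[mu]_(s in `[0, t]) (q1 s * w s) + \int[mu]_(s in `[0, t]) (q2 s * w s).
  by rewrite -RintegralD//; apply: eq_Rintegral => s _; rewrite -mulrDl -q12.
have h1 : m t * q1 a <= \int[mu]_(s in `[0, t]) (q1 s * w s).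
  apply: monotone_weight_le => //; first by rewrite a0.
  move=> s sa; rewrite tail ?lerBrDr ?gerDl ?ma//.
  by case/andP: sa => -> /= /le_trans; apply.
have h2 : - e * q2 t <= \int[mu]_(s in `[0, t]) (q2 s * w s).
  apply: monotone_weight_le => //; first by rewrite t0/=.
  move=> s st; rewrite tail// lerBrDr addrC lerBlDr.
  have [sa|/ltW sa] := leP s a.
    rewrite (@le_trans _ _ 0)//; first by apply: ma; case/andP: st => ->.
    by rewrite addr_ge0// ltW.
  by apply: mt; case/andP: st => _ ->; rewrite sa.
have h3 : - e <= - e * q2 t.
  rewrite mulNr lerN2 ler_piMr// q2t gerBl; by case/andP: (k01 (t - a)).
rewrite q1a mulrC in h1; rewrite -[k (t - a)]/(q a).
exact: lerD h1 (le_trans h3 h2).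
Qed.

(** The inequality for m is known only almost everywhere, so the lower bound is
    applied at a point t close to a maximum point c of m on [a, a + delta], on its
    left, where m t is within e of the maximum. *)
Lemma volterra_step a : 0 <= a <= T -> (forall s, 0 <= s <= a -> m s <= 0) ->
  forall s, 0 <= s <= T -> s <= a + delta -> m s <= 0.
Proof.
move=> /andP[a0 aT] ma.
pose b := Num.min (a + delta) T.
have ab : a <= b by rewrite /b le_min aT lerDl ltW.
have bT : b <= T by rewrite /b ge_min lexx orbT.
suff mb s : a <= s <= b -> m s <= 0.
  move=> s /andP[s0 sT] sd; have [sa|/ltW sa] := leP s a; first by apply: ma; rewrite s0.
  by apply: mb; rewrite sa /b le_min sd sT.
have mcab : {within `[a, b], continuous m}.
  apply: continuous_subspaceW mcont => x /=; rewrite !in_itv/= => /andP[ax xb].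
  by rewrite (le_trans a0 ax) (le_trans xb bT).
(* c is a maximum point of m on [a, b]; the value there is shown not to be
   positive. *)
have [c cab mc] := EVT_max ab mcab.
move=> sab; apply: (@le_trans _ _ (m c)).
  by apply: mc; rewrite in_itv.
rewrite leNgt; apply/negP => mc0.
move: cab; rewrite in_itv/= => /andP[ac cb].
have ac' : a < c.
  rewrite lt_neqAle ac andbT; apply/negP => /eqP ac'.
  by move: mc0; rewrite -ac' ltNge ma// a0 lexx.
pose eta := k delta - kappa.
have eta0 : 0 < eta by rewrite subr_gt0.
have eta1 : eta <= 1 by rewrite lerBlDr; case/andP: (k01 delta) => _; move: kappa_ge0; lra.
(* With this e the final inequality eta * m t <= e, where m t >= (3 / 4) * m c,
   would give 3 / 4 <= 1 / 4. *)
pose e := eta * m c / 4.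
have e0 : 0 < e by rewrite divr_gt0// mulr_gt0.
have c0 : 0 < c by exact: le_lt_trans ac'.
have cT : c <= T by exact: le_trans bT.
have T0 : 0 < T by exact: lt_le_trans cT.
have [d d0 dP] : exists2 d, 0 < d & forall x, c - d < x < c -> 0 <= x -> m c - e < m x.
  have cl : m x @[x --> c^'-] --> m c.
    have [->|cT'] := eqVneq c T; first by have /(continuous_within_itvP _ T0)[] := mcont.
    apply/cvg_at_left_filter.
    apply: (within_continuous_continuous T0 mcont); rewrite in_itv/= c0/=.
    by rewrite lt_neqAle cT'.
  move/cvgrPdist_lt : cl => /(_ _ e0)[d/= d0 dP]; exists d => // x /andP[cdx xc] x0.
  have := dP x; rewrite /ball_/= ger0_norm ?subr_ge0 ?(ltW xc)// => /(_ _ xc) h.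
  have := h ltac:(by rewrite ltrBlDl -ltrBlDr); rewrite ltr_norml => /andP[_].
  by rewrite ltrBlDl -ltrBlDr.
have xc : Num.max a (c - d) < c by rewrite gt_max ac'/= gtrBl.
have [t /andP[xt tc] tP] := ae_exists_itv mineq xc.
move: xt; rewrite gt_max => /andP[at_ dt].
have t0 : 0 <= t by rewrite (le_trans a0)// ltW.
have tT : t <= T by rewrite (le_trans (ltW tc)).
have mtc : m c - e < m t by apply: dP => //; rewrite dt.
have em : e <= m c / 4 by rewrite /e ler_wpM2r// ler_piMl// ltW.
have mt0 : 0 < m t by lra.
have t0T : 0 <= t <= T by rewrite t0.
have up := tP t0T mt0.
have mst s' : a <= s' <= t -> m s' <= m t + e.
  move=> /andP[as' s't]; rewrite (@le_trans _ _ (m c))//; last lra.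
  by apply: mc; rewrite in_itv/= as' (le_trans s't)// (le_trans (ltW tc)).
have a0t : 0 <= a <= t by rewrite a0 ltW.
have low := convolution_lower_bound a0t tT (ltW e0) mt0 ma mst.
have kd : k delta <= k (t - a).
  apply: kinc; rewrite lerBlDl (le_trans (ltW tc))// (le_trans cb)//.
  by rewrite /b ge_min lexx.
have h : (eta * m t <= e).
  have := le_trans low up; have := ler_wpM2r (ltW mt0) kd; rewrite /eta; nra.
have : eta * (m c * 3 / 4) <= e.
  by apply: le_trans h; rewrite ler_wpM2l ?(ltW eta0)//; lra.
rewrite /e !mulrA; have := mulr_gt0 eta0 mc0; move: (eta * m c) => x; lra.
Qed.

Lemma volterra_comparison : 0 <= T -> m 0 <= 0 -> forall t, 0 <= t <= T -> m t <= 0.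
Proof.
move=> T0 m0.
suff main (n : nat) t : 0 <= t <= T -> t <= n%:R * delta -> m t <= 0.
  move=> t t0T; apply: (main (Num.truncn (t / delta)).+1) => //.
  rewrite -ler_pdivrMr//; apply: ltW; apply: Num.Theory.truncnS_gt.
elim: n t => [|n IH] t t0T tn.
  by rewrite (_ : t = 0)//; case/andP: t0T => t0 _; apply/le_anti; rewrite t0 andbT; lra.
have [nT|nT] := leP (n%:R * delta) T; last first.
  by apply: IH => //; case/andP: t0T => _ /le_trans; apply; exact: ltW.
apply: (@volterra_step (n%:R * delta)) => //.
- by rewrite mulr_ge0// ltW.
- move=> s /andP[s0 sn]; apply: IH => //; rewrite s0; exact: le_trans nT.
- by rewrite -natr1 mulrDl mul1r in tn.
Qed.
End volterra.
End comparison.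

(** * The hybrid problem *)

Section hybrid_problem.
Context {R : realType}.
Implicit Types (a b s t T x y : R).
Local Notation mu := (@lebesgue_measure R).

Lemma abs_continuous_within T (x : R -> R) : abs_continuous T x ->
  {within `[0, T], continuous x}.
Proof.
move=> xac; apply/subspace_continuousP => t /=; rewrite in_itv/= => /andP[t0 tT].
apply/cvgrPdist_lt => e /xac[d d0 dP].
rewrite near_withinE; near=> s; rewrite /= in_itv/= => /andP[s0 sT].
have one a b : 0 <= a -> a <= b -> b <= T -> b - a < d -> `|x b - x a| < e.
  move=> a0 ab bT abd.
  have := dP 1%N (fun=> a) (fun=> b); rewrite !big_ord1; apply => //.
  by move=> i j _ _ _; rewrite (ord1 i) (ord1 j).
have std : `|t - s| < d by near: s; exists d.
have [st|/ltW ts] := leP s t.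
  by apply: one => //; rewrite ger0_norm ?subr_ge0 in std.
by rewrite distrC; apply: one => //; rewrite distrC ger0_norm ?subr_ge0 in std.
Unshelve. all: by end_near. Qed.

(** The graph map t |-> (t, u t) is continuous into J * R, the set relative to
    which f is continuous. *)
Lemma hybrid_quotient_continuous T (f : R -> R -> R) (u : R -> R) :
  {within `[0, T] `*` [set: R], continuous (fun p : R * R => f p.1 p.2)} ->
  (forall tau x, 0 <= tau <= T -> f tau x <> 0) ->
  abs_continuous T u ->
  {within `[0, T], continuous (hybrid_quotient f u)}.
Proof.
move=> fc f0 /abs_continuous_within uc.
apply/subspace_continuousP => t tT.
have t0T : 0 <= t <= T by move: tT; rewrite /= in_itv.
have ut : u s @[s --> within `[0, T] (nbhs t)] --> u t.
  by move/subspace_continuousP : uc; apply.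
apply: cvgM => //; apply: cvgV; first by apply/eqP; exact: f0.
have /subspace_continuousP/(_ (t, u t)) fp := fc.
have tuD : (`[0, T] `*` [set: R]) (t, u t) by split.
apply: (@cvg_comp _ _ _ (fun s => (s, u s)) (fun p : R * R => f p.1 p.2) _
  (within (`[0, T] `*` [set: R]) (nbhs (t, u t)))); last exact: fp tuD.
move=> A; rewrite /= !nbhs_simpl /= => nA.
have tu : (s, u s) @[s --> within `[0, T] (nbhs t)] --> (t, u t).
  apply: (@cvg_pair _ _ _ _ (nbhs t) (nbhs (u t)) _ _ _ (fun s => s) u) => //.
  exact: cvg_within.
have nA' : nbhs t (fun s => `[0, T]%classic s ->
  (`[0, T] `*` [set: R]) (s, u s) -> A (s, u s)) := tu _ nA.
by apply: filterS nA' => s h sT; exact: h.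
Qed.

(** The kernel of the ABC derivative, extended by the constant 1 to negative
    times so that it is monotone on the whole line. *)
Definition abc_kernel (alpha t : R) : R :=
  mittag_leffler alpha (- (alpha / (1 - alpha) * Num.max 0 t `^ alpha)).

Section kernel.
Variable alpha : R.
Hypotheses (alpha_gt0 : 0 < alpha) (alpha_lt1 : alpha < 1).

Let lam_gt0 : 0 < alpha / (1 - alpha).
Proof. by rewrite divr_gt0// subr_gt0. Qed.

Let arg_ge0 t : 0 <= alpha / (1 - alpha) * Num.max 0 t `^ alpha.
Proof. by rewrite mulr_ge0 ?powR_ge0// ltW. Qed.

Lemma abc_kernel0 : abc_kernel alpha 0 = 1.
Proof.
by rewrite /abc_kernel maxxx powR0 ?gt_eqF// mulr0 oppr0 mittag_leffler0// ltW.
Qed.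

Lemma abc_kernel_noninc s t : s <= t -> abc_kernel alpha t <= abc_kernel alpha s.
Proof.
move=> st; apply: mittag_leffler_noninc; rewrite ?(ltW alpha_lt1)// arg_ge0/=.
have max0 x : 0 <= Num.max 0 x by rewrite le_max lexx.
rewrite ler_wpM2l ?(ltW lam_gt0)// ge0_ler_powR ?(ltW alpha_gt0)// ?nnegrE//.
exact: le_max2.
Qed.

Lemma abc_kernel01 t : 0 <= abc_kernel alpha t <= 1.
Proof.
rewrite mittag_leffler_ge0 ?(ltW alpha_lt1)//= -(mittag_leffler0 alpha_gt0 (ltW alpha_lt1)).
by rewrite -[X in _ <= mittag_leffler _ X]oppr0 mittag_leffler_noninc ?(ltW alpha_lt1)// lexx arg_ge0.
Qed.

Lemma abc_kernel_near0 (kappa : R) : kappa < 1 ->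
  exists2 d, 0 < d & kappa < abc_kernel alpha d.
Proof.
move=> k1; have [C C0 CP] := mittag_leffler_near0 alpha_gt0 (ltW alpha_lt1).
have C1 : 0 < C + 1 by rewrite ltr_wpDl.
(* y is chosen so that C * y < 1 - kappa, and d is the time at which the
   argument of the Mittag-Leffler function is - y. *)
pose y := Num.min 1 ((1 - kappa) / (C + 1) / 2).
have y0 : 0 < y by rewrite lt_min ltr01/= !divr_gt0// subr_gt0.
have yk : y <= (1 - kappa) / (C + 1) / 2 by rewrite ge_min lexx orbT.
have y1 : y <= 1 by rewrite ge_min lexx.
pose d := (y / (alpha / (1 - alpha))) `^ alpha^-1.
have d0 : 0 < d by rewrite powR_gt0// divr_gt0.
exists d => //; rewrite /abc_kernel max_r ?(ltW d0)// /d -powRrM mulVf ?gt_eqF//.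
have yl0 : 0 <= y / (alpha / (1 - alpha)) by rewrite divr_ge0 ?ltW.
rewrite powRr1// mulrCA divff ?gt_eqF// mulr1.
have := CP y ltac:(by rewrite y1 ltW); rewrite ler_norml => /andP[h _].
have : C * y < 1 - kappa.
  have : (C + 1) * y <= (1 - kappa) / 2.
    by rewrite mulrC -ler_pdivlMr// mulrAC.
  nra.
lra.
Qed.

(** In the integral t - s >= 0, so the truncation in [abc_kernel] is
    invisible. *)
Lemma ABC_deriveE (B : R -> R) T (x : R -> R) t :
  ABC_derive B alpha T x t = B alpha / (1 - alpha) *
    \int[mu]_(s in `[0, t]) (abc_kernel alpha (t - s) * weak_derive T x s).
Proof.
rewrite /ABC_derive; congr (_ * _); apply: eq_Rintegral => s.
rewrite inE/= in_itv/= => /andP[s0 st].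
by rewrite /abc_kernel max_r ?subr_ge0// mulNr.
Qed.
End kernel.

(** The choice made in [weak_derive] is legitimate on in_H1. *)
Lemma weak_deriveP T (x : R -> R) : 0 < T -> in_H1 T x ->
  mu.-integrable `[0, T] (EFin \o weak_derive T x) /\
  is_weak_derivative T x (weak_derive T x).
Proof.
move=> T0 [_ xH].
have [v2 vw] : H1_derivatives T x (weak_derive T x) by exact: xgetPex.
by split => //; apply: integrable_itv_oo_cc => //; exact: square_integrable_integrable.
Qed.
End hybrid_problem.

Theorem theorem6p1 (R : realType) (B : R -> R)
    (B_gt0 : forall a : R, 0 <= a <= 1 -> 0 < B a) (B0 : B 0 = 1) (B1 : B 1 = 1)
    (T alpha w0 : R) (T_gt0 : 0 < T) (alpha_gt0 : 0 < alpha) (alpha_lt1 : alpha < 1)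
    (f g : R -> R -> R)
    (f_cont : {within `[0, T] `*` [set: R], continuous (fun p : R * R => f p.1 p.2)})
    (f_neq0 : forall tau x : R, 0 <= tau <= T -> f tau x <> 0)
    (f_ac : forall x : R, abs_continuous T (fun tau => x / f tau x))
    (g_cont : {within `[0, T] `*` [set: R], continuous (fun p : R * R => g p.1 p.2)})
    (g0 : g 0 w0 = 0)
    (L : R) (L_gt0 : 0 < L)
    (f_lipschitz : forall tau x y : R, 0 <= tau <= T ->
       `|f tau x - f tau y| <= L * `|x - y|)
    (f_incr : forall tau : R, 0 <= tau <= T ->
       forall x y : R, x < y -> x / f tau x < y / f tau y)
    (h : R -> R)
    (h_cont : {within `[0, T], continuous h})
    (h_ge0 : forall tau : R, 0 <= tau <= T -> 0 <= h tau)
    (g_bound : {ae lebesgue_measure, forall tau : R, 0 <= tau <= T ->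
       forall x : R, `|g tau x| <= h tau})
    (small : L * (`|w0 / f 0 w0| +
       (1 - alpha + T `^ alpha / (1 - alpha)) *
       (sup [set `|h tau| | tau in `[0, T]] / B alpha)) < 1)
    (g_onesided : exists K : R, [/\ 0 < K, K < B alpha / (1 - alpha) &
       forall tau x y : R, 0 <= tau <= T -> y <= x ->
         g tau x - g tau y <= K * (x / f tau x - y / f tau y)])
    (u : R -> R)
    (u_ac : abs_continuous T u)
    (u_H1 : in_H1 T (hybrid_quotient f u))
    (u_ineq : {ae lebesgue_measure, forall tau : R, 0 <= tau <= T ->
       ABC_derive B alpha T (hybrid_quotient f u) tau <= g tau (u tau)})
    (u0 : u 0 <= w0)
    (r : R -> R)
    (r_max : is_maximal_solution B alpha T w0 f g r) :
  forall tau : R, 0 <= tau <= T -> u tau <= r tau.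
Proof.
have [[r_ac r_H1 _ r_eq r0] _] := r_max.
have [K [K0 KB gK]] := g_onesided.
pose c := B alpha / (1 - alpha).
have c0 : 0 < c by exact: lt_trans KB.
pose U := hybrid_quotient f u; pose V := hybrid_quotient f r.
pose m t := U t - V t.
have Uc : {within `[0, T], continuous U} by exact: hybrid_quotient_continuous.
have Vc : {within `[0, T], continuous V} by exact: hybrid_quotient_continuous.
have [Ui Uw] := weak_deriveP T_gt0 u_H1.
have [Vi Vw] := weak_deriveP T_gt0 r_H1.
pose w s := weak_derive T U s - weak_derive T V s.
have quotient_le t x y : 0 <= t <= T -> x <= y -> x / f t x <= y / f t y.
  by move=> tT; rewrite le_eqVlt => /predU1P[->//|xy]; exact/ltW/f_incr.
have m_le t : 0 <= t <= T -> m t <= 0 -> u t <= r t.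
  move=> tT; rewrite subr_le0 leNgt => mt; rewrite leNgt.
  by apply: contra mt => /(f_incr t tT).
have m_gt t : 0 <= t <= T -> 0 < m t -> r t <= u t.
  move=> tT; rewrite subr_gt0 => mt; rewrite leNgt; apply/negP => /ltW ur.
  by move: mt; rewrite ltNge quotient_le.
have kappa1 : K / c < 1 by rewrite ltr_pdivrMr// mul1r.
have [d d0 dk] := abc_kernel_near0 alpha_gt0 alpha_lt1 kappa1.
have k01 := abc_kernel01 alpha_gt0 alpha_lt1.
have k0 := abc_kernel0 alpha_gt0 alpha_lt1.
have kinc := abc_kernel_noninc alpha_gt0 alpha_lt1.
have ABCE := ABC_deriveE alpha B T.
(* From here on k is an arbitrary kernel with these properties. *)
move: (abc_kernel alpha) dk k01 k0 kinc ABCE => k dk k01 k0 kinc ABCE.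
have mc : {within `[0, T], continuous m}.
  by move=> t; apply: cvgB; [exact: Uc|exact: Vc].
have mI (b : R) : measurable (`[0, b]%classic : set R) by [].
have wi : (@lebesgue_measure R).-integrable `[0, T] (EFin \o w).
  exact: integrableB_EFin.
have intS t (v : R -> R) : t <= T -> (@lebesgue_measure R).-integrable `[0, T] (EFin \o v) ->
    (@lebesgue_measure R).-integrable `[0, t] (EFin \o v).
  by move=> tT; apply: integrableS => //; apply: subset_itvl; rewrite bnd_simp.
have mw t : 0 <= t <= T -> m t - m 0 = \int[lebesgue_measure]_(s in `[0, t]) w s.
  move=> t0T; have /andP[t0 tT] := t0T.
  rewrite RintegralB//; [|exact: intS..].
  rewrite -(weak_derivative_primitive T_gt0 Uc Ui Uw t0T).
  by rewrite -(weak_derivative_primitive T_gt0 Vc Vi Vw t0T) /m; ring.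
have mineq : {ae lebesgue_measure, forall t, 0 <= t <= T -> 0 < m t ->
    \int[lebesgue_measure]_(s in `[0, t]) (k (t - s) * w s) <= K / c * m t}.
  have aeF : Filter (almost_everywhere (@lebesgue_measure R)).
    exact: (@ae_filter_ringOfSetsType _ _ _ (@lebesgue_measure R)).
  apply: filterS2 u_ineq r_eq => t ut rt t0T mt; have /andP[t0 tT] := t0T.
  have := ut t0T; have := rt t0T; rewrite !ABCE => rt' ut'.
  have ki (v : R -> R) : (@lebesgue_measure R).-integrable `[0, T] (EFin \o v) ->
      (@lebesgue_measure R).-integrable `[0, t] (EFin \o (fun s => k (t - s) * v s)).
    move=> vi; apply: (@integrable_bounded_mul _ _ _ _ 1 (mI t) (intS _ _ tT vi)).
      apply: nondecreasing_measurable => // x y xy.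
      by apply: kinc; rewrite lerD2l lerN2.
    move=> s _; have /andP[kt0 kt1] := k01 (t - s).
    by rewrite ger0_norm.
  have -> : \int[lebesgue_measure]_(s in `[0, t]) (k (t - s) * w s) =
      \int[lebesgue_measure]_(s in `[0, t]) (k (t - s) * weak_derive T U s) -
      \int[lebesgue_measure]_(s in `[0, t]) (k (t - s) * weak_derive T V s).
    rewrite -RintegralB//; [|exact: ki..].
    by apply: eq_Rintegral => s _; rewrite mulrBr.
  rewrite mulrAC ler_pdivlMr// mulrC mulrBr.
  apply: le_trans (gK t (u t) (r t) t0T (m_gt t t0T mt)).
  by rewrite -rt' lerB.
have m0 : m 0 <= 0.
  rewrite subr_le0 /U /V /hybrid_quotient r0; apply: quotient_le => //.
  by rewrite lexx ltW.
move=> t t0T; apply: m_le => //.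
apply: (@volterra_comparison _ T (K / c) d k m w) => //.
- by rewrite divr_ge0// ltW.
- exact: ltW.
Qed.
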